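(* For every positive integer $k$ there exists $c=c(k)>0$ such that the following holds. Every graph $G$ of average degree at least $d$ either contains an induced $C_4$-free subgraph with average degree at least $k$, or it contains a subgraph on $d$ vertices with at least $cd^2$ edges.
   Context: An induced $C_4$-free subgraph of $G$ is an induced subgraph of $G$ that contains no cycle of length $4$ as a (not necessarily induced) subgraph.
   Formalization: The integer d is required to be at least 2: for d = 1 and k at least 2 the claim fails for a single edge K_2, since a one-vertex subgraph has no edges, and d = 0 is trivial. *)

(* Defs.v *)
From HB Require Import structures.
From mathcomp Require Import all_boot all_order all_algebra reals.

Set Implicit Arguments.
Unset Strict Implicit.
Unset Printing Implicit Defensive.

Import Order.TTheory GRing.Theory Num.Theory.
Local Open Scope ring_scope.

Record sgraph := SGraph {
  vertex :> finType;
  adj : rel vertex;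
  adj_sym : symmetric adj;
  adj_irr : irreflexive adj }.

Definition degree (G : sgraph) (x : G) : nat := #|[set y : G | adj x y]|.

Definition edges (G : sgraph) : {set {set G}} :=
  [set [set p.1; p.2] | p : G * G & adj p.1 p.2].

(* Division by zero gives average degree 0 to the graph with no vertices. *)
Definition avg_degree (R : realType) (G : sgraph) : R :=
  (\sum_(x : G) degree x)%N%:R / #|G|%:R.

Section Induced.
Variables (G : sgraph) (S : {set G}).

Definition induced_adj : rel {x : G | x \in S} :=
  fun x y => adj (val x) (val y).

Lemma induced_sym : symmetric induced_adj.
Proof. by move=> x y; apply: adj_sym. Qed.

Lemma induced_irr : irreflexive induced_adj.
Proof. by move=> x; apply: adj_irr. Qed.

Definition induced : sgraph := SGraph induced_sym induced_irr.
End Induced.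

(* H is, up to isomorphism, a (not necessarily induced) subgraph of G. *)
Definition is_subgraph (H G : sgraph) : Prop :=
  exists f : H -> G, injective f /\ {homo f : x y / adj x y}.

(* A 4-cycle through four distinct vertices; chords are allowed, so the
   forbidden cycle is not required to be induced. *)
Definition C4_free (G : sgraph) : Prop :=
  ~ exists s : seq G, size s = 4 /\ ucycle (@adj G) s.

(* Main.v *)
Require Import Defs.
From mathcomp Require Import all_boot all_order all_algebra reals.
From mathcomp Require Import zify ring.

(** Suppose that G has average degree at least d and that every set of d
vertices spans fewer than d^2 / N ordered edges, with N huge in terms of k.
Averaging shows that every set of O(d) vertices is then sparse
(local_sparsity), and small d are absorbed by N. The task is to find an induced
C4-free subgraph of average degree at least k.

Let S0 be a minimal vertex set of average degree at least d. It can be oriented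
with out-degrees at most 2d (minimal_dense_subset, bounded_orientation), and a
positive proportion A0 of S0 has out-degree at least d/4 and degree at most
64d. For a set X of vertices, the star of X at b consists of the points of X
that have b as an out-neighbour. Call X dead if it has many points, in units of
d, but only a small fraction of its out-edges lead to vertices whose star is
large. There are three cases.

If A0 is dead, then a positive proportion of its out-edges end in vertices of
degree O(d) (dead_singles_dense). So the vertices of degree O(d) induce at least
a constant times d #|S0| edges, and local sparsity bounds their number of
four-cycles by a small multiple of d^3 per vertex. A random set of vertices of
density of order k/d, with the vertices on four-cycles deleted, still has average
degree at least k (light_C4_free_dense).

The other two cases end with a linear design (linear_design_C4_free_dense):
disjoint independent sets A and V with #|V| <= #|A| such that every point of A
has at least k neighbours in V and two points of A have at most one common
neighbour there.

If a positive proportion of the out-edges of some X lead to vertices b with a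
dead star (dead_pairs_C4_free_dense), then for a typical a in X most pairs of
such out-neighbours have few common in-neighbours in X. There are few such b,
because each has a large star. So a random set V containing a proportion 1/d of
them is small, while with probability bounded below a typical a sees exactly k
elements of V, pairwise with few common in-neighbours (random_class). Joining the
points that share two elements of V gives a conflict graph of degree O(d), and an
independent set in it is the side A of a linear design.

Otherwise, starting at A0 and passing to stars k times, a constant proportion of
the out-edges survives every time (dead_or_rich). So some a has a
positive proportion of its k-tuples of out-neighbours with many common
in-neighbours (rich_alive). By convexity, a positive proportion of the k-by-p
arrays of out-neighbours of a have this property for all the k-tuples that
select one entry in every row (blow_up); take p to be a prime, p >= k. The p^2
lines of the affine plane over F_p are such selections. Choosing for each line a
common in-neighbour of its k entries that is adjacent to no other entry, greedily
so that the choices are independent, gives a linear design with p^2 points over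
k p entries, in which two lines meet at most once (alive_C4_free_dense).

Probabilities are counts of functions, and all constants are natural numbers;
the real constant is 1 / (2 N). *)

Set Implicit Arguments.
Unset Strict Implicit.
Unset Printing Implicit Defensive.

Import GRing.Theory.

(** * Counting tools *)

(** Exchanging the stored value get z with a fresh x is an involution of the
pairs (z, x): overwriting one coordinate by a uniform element of M preserves
the uniform distribution on zs. *)
Lemma sum_resample (Z V : finType) (zs : {pred Z}) (M : {pred V})
    (get : Z -> V) (upd : Z -> V -> Z) (F : Z -> nat) :
  (forall z, z \in zs -> get z \in M) ->
  (forall z x, z \in zs -> x \in M -> upd z x \in zs) ->
  (forall z x, get (upd z x) = x) ->
  (forall z x, upd (upd z x) (get z) = z) ->
  \sum_(z in zs) \sum_(x in M) F (upd z x) = #|M| * \sum_(z in zs) F z.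
Proof.
move=> getM updM getK updK.
pose h (p : Z * V) := (upd p.1 p.2, get p.1).
have hK : involutive h by case=> z x; rewrite /h /= updK getK.
rewrite pair_big /= (reindex_inj (inv_inj hK)) /=.
transitivity (\sum_(p | (p.1 \in zs) && (p.2 \in M)) F p.1).
  apply: eq_big => [[z x]|[z x] _]; last by rewrite /h /= updK.
  rewrite /h /=; apply/andP/andP => -[Hz Hx].
    split; last by rewrite -(getK z x); exact: getM.
    by rewrite -(updK z x); exact: updM.
  by split; [exact: updM | exact: getM].
rewrite -(pair_big (fun z => z \in zs) (fun x => x \in M) (fun z x => F z)) /=.
by rewrite big_distrr /=; apply: eq_bigr => z _; rewrite sum_nat_const.
Qed.

Definition overwrite (I V : finType) (f : {ffun I -> V}) (c : I) (y : V) :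
  {ffun I -> V} := [ffun i => if i == c then y else f i].

(** Expose coordinate c last: whatever the other coordinates are, E then has
conditional probability at most b / #|M|. *)
Lemma event_resample (I V : finType) (M : {set V}) (E : pred {ffun I -> V})
    (c : I) (b : nat) :
  (forall f, f \in ffun_on (mem M) ->
     #|[set y in M | E (overwrite f c y)]| <= b) ->
  #|[set f in ffun_on (mem M) | E f]| * #|M| <= b * #|M| ^ #|I|.
Proof.
move=> Hb; rewrite -card_ffun_on.
have := @sum_resample _ _ (ffun_on (mem M)) (mem M)
  (fun f : {ffun I -> V} => f c) (fun f y => overwrite f c y) (fun f => (E f : nat)).
move=> Hr; rewrite mulnC -sum1dep_card big_mkcondr /= -Hr; first last.
- move=> f x; apply/ffunP=> i; rewrite !ffunE.
  by case: eqP => // ->.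
- by move=> f x; rewrite ffunE eqxx.
- move=> f x /ffun_onP Hf Hx; apply/ffun_onP=> i; rewrite ffunE.
  by case: ifP.
- by move=> f /ffun_onP; apply.
rewrite mulnC -sum_nat_const; apply: leq_sum => f Hf.
apply: leq_trans (Hb f Hf); rewrite -sum1dep_card big_mkcondr /=.
by apply: leq_sum => y _; case: (E _).
Qed.

Lemma union_resample (I V : finType) (S : finType) (M : {set V})
    (E : S -> pred {ffun I -> V}) (c : S -> I) (b : nat) :
  (forall s f, f \in ffun_on (mem M) ->
     #|[set y in M | E s (overwrite f (c s) y)]| <= b) ->
  #|[set f in ffun_on (mem M) | [exists s, E s f]]| * #|M|
    <= #|S| * b * #|M| ^ #|I|.
Proof.
move=> Hb; apply: (@leq_trans
  (\sum_(s : S) #|[set f in ffun_on (mem M) | E s f]| * #|M|)).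
  rewrite -big_distrl /= leq_mul2r; apply/orP; right.
  under [leqRHS]eq_bigr => s _ do rewrite -sum1dep_card big_mkcondr /=.
  rewrite exchange_big /= -sum1dep_card big_mkcondr /=.
  apply: leq_sum => f _; case: existsP => // -[s Es].
  by rewrite (bigD1 s) //= Es.
rewrite -mulnA -sum_nat_const; apply: leq_sum => s _.
exact: event_resample (Hb s).
Qed.

(** Chebyshev's sum inequality: r ^ m and r are similarly ordered. *)
Lemma sum_exp_chebyshev (Y : finType) (P : {pred Y}) (r : Y -> nat) m :
  (\sum_(y in P) r y ^ m) * (\sum_(y in P) r y)
    <= #|P| * \sum_(y in P) r y ^ m.+1.
Proof.
have key a b : a ^ m * b + b ^ m * a <= a ^ m.+1 + b ^ m.+1.
  wlog le_ab : a b / a <= b.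
    by move=> H; case/orP: (leq_total a b) => /H //; rewrite addnC [in X in _ <= X]addnC.
  have le_m : a ^ m <= b ^ m by case: m => // m; rewrite leq_exp2r.
  rewrite !expnS; nia.
rewrite -(leq_pmul2l (isT : 0 < 2)) !mul2n -!addnn.
have e1 : (\sum_(y in P) r y ^ m) * (\sum_(y in P) r y)
   = \sum_(x in P) \sum_(y in P) r x ^ m * r y.
  by rewrite big_distrl /=; apply: eq_bigr => x _; rewrite big_distrr.
have e2 : #|P| * (\sum_(y in P) r y ^ m.+1)
   = \sum_(x in P) \sum_(y in P) r x ^ m.+1.
  by rewrite big_distrr /=; apply: eq_bigr => x _; rewrite sum_nat_const.
rewrite e1 e2 {2}exchange_big /= [in X in _ <= _ + X]exchange_big /= -!big_split /=.
apply: leq_sum => x _; rewrite -!big_split /=; apply: leq_sum => y _.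
exact: key.
Qed.

(** Jensen's inequality for x ^ m.+1, with the denominators cleared. *)
Lemma power_mean (Y : finType) (P : {pred Y}) (r : Y -> nat) m :
  (\sum_(y in P) r y) ^ m.+1 <= #|P| ^ m * \sum_(y in P) r y ^ m.+1.
Proof.
elim: m => [|m IHm]; first by rewrite expn0 mul1n expn1; apply: eq_leq; apply: eq_bigr => y _; rewrite expn1.
rewrite expnSr; apply: leq_trans (leq_mul IHm (leqnn _)) _.
rewrite -mulnA expnSr -mulnA leq_mul2l sum_exp_chebyshev orbT //.
Qed.

(** The colours of distinct vertices are independent, which gives the probability
(1/q) ^ #|Z| (1 - 1/q) ^ #|W|. *)
Lemma card_colourings (T : finType) (q : nat) (c0 : 'I_q) (Z W : {set T}) :
  [disjoint Z & W] ->
  #|[set f : {ffun T -> 'I_q} |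
      [forall x in Z, f x == c0] && [forall x in W, f x != c0]]|
    * q ^ (#|Z| + #|W|) = q.-1 ^ #|W| * q ^ #|T|.
Proof.
move=> dZW.
pose F (x : T) : pred 'I_q :=
  if x \in Z then pred1 c0 else if x \in W then predC1 c0 else predT.
have -> : #|[set f : {ffun T -> 'I_q} |
    [forall x in Z, f x == c0] && [forall x in W, f x != c0]]| = #|family F|.
  apply: eq_card => f; rewrite inE; apply/andP/familyP => [[/forall_inP HZ /forall_inP HW] x|Hf].
    rewrite /F; case: ifP => [/HZ //|_]; case: ifP => [/HW //|//].
  split; apply/forall_inP => x Hx; move: (Hf x); rewrite /F ?Hx //.
  by rewrite (disjointFl dZW Hx).
have cq : #|'I_q| = q by rewrite card_ord.
have prodZ (A : {set T}) a : a ^ #|A| = \prod_(x : T) (if x \in A then a else 1).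
  by rewrite -big_mkcond /= prod_nat_const.
rewrite card_family foldrE big_map big_enum /= expnD !prodZ.
have -> : q ^ #|T| = \prod_(x : T) q by rewrite prod_nat_const.
rewrite -!big_split /=; apply: eq_bigr => x _.
rewrite /F; case: ifP => HZ.
  by rewrite (disjointFr dZW HZ) card1 mul1n muln1 mul1n.
case: ifP => HW; last by rewrite !muln1 mul1n -[RHS]cq.
rewrite mul1n; congr muln; have := cardC1 c0; rewrite cq => <-.
exact: eq_card.
Qed.

Lemma card_colourings0 (T : finType) (q : nat) (c0 : 'I_q) (Z : {set T}) :
  #|[set f : {ffun T -> 'I_q} | [forall x in Z, f x == c0]]| * q ^ #|Z|
    = q ^ #|T|.
Proof.
have := @card_colourings T q c0 Z set0; rewrite disjoint_sym -setI_eq0 set0I eqxx.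
move=> /(_ isT); rewrite cards0 addn0 mul1n => <-; congr (_ * _).
apply: eq_card => f; rewrite !inE; symmetry; apply: andb_idr => _.
by apply/forall_inP => x; rewrite inE.
Qed.

Lemma leq_card_bigcup (I T : finType) (P : {pred I}) (F : I -> {set T}) :
  #|\bigcup_(i in P) F i| <= \sum_(i in P) #|F i|.
Proof.
elim/big_rec2: _ => [|i m A _ IH]; first by rewrite cards0.
by apply: leq_trans (leq_card_setU _ _) _; rewrite leq_add2l.
Qed.

(** A maximal independent subset dominates X, and each of its points dominates
at most D.+1 points. *)
Lemma independent_subset (T : finType) (R : rel T) (X : {set T}) (D : nat) :
  symmetric R -> (forall x, x \in X -> #|[set y in X | R x y]| <= D) ->
  exists I : {set T}, [/\ I \subset X,
    {in I &, forall x y, x != y -> ~~ R x y} & #|X| <= D.+1 * #|I|].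
Proof.
move=> Rsym degX.
pose P (J : {set T}) :=
  (J \subset X) && [forall x in J, forall y in J, (x != y) ==> ~~ R x y].
have P0 : P set0.
  by rewrite /P sub0set; apply/forall_inP => x; rewrite inE.
have [I /maxsetP[/andP[sIX /forall_inP indI] maxI] _] := maxset_exists P0.
have {}indI : {in I &, forall x y, x != y -> ~~ R x y}.
  by move=> x y xI yI; apply/implyP; have /forall_inP := indI x xI; apply.
exists I; split => //.
have cov : X \subset \bigcup_(y in I) (y |: [set z in X | R y z]).
  apply/subsetP => x xX; apply/bigcupP; case xI: (x \in I).
    by exists x => //; rewrite setU11.
  case: (boolP [exists y in I, R y x]) => [/exists_inP[y yI Ryx]|/exists_inPn noR].
    by exists y => //; rewrite !inE xX Ryx orbT.
  have: P (x |: I).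
    rewrite /P subUset sub1set xX sIX /=; apply/forall_inP => u uI; apply/forall_inP => v vI.
    apply/implyP => nuv; move: uI vI nuv; rewrite !inE.
    case/orP => [/eqP->|uI]; case/orP => [/eqP->|vI]; rewrite ?eqxx //.
    - by rewrite Rsym noR.
    - by rewrite noR.
    - exact: indI.
  by move=> /maxI/(_ (subsetUr _ _)) eI; rewrite -eI setU11 in xI.
apply: leq_trans (subset_leq_card cov) _.
apply: leq_trans (leq_card_bigcup _ _) _.
rewrite mulnC -sum_nat_const; apply: leq_sum => y yI.
apply: leq_trans (leq_card_setU _ _) _; rewrite cards1 add1n ltnS.
exact: degX (subsetP sIX y yI).
Qed.

(** Choose representatives one at a time: every earlier choice excludes at most
D.+1 elements, and X s has more than #|S| * D.+1. *)
Lemma greedy_transversal (S T : finType) (R : rel T) (X : S -> {set T}) (D : nat) :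
  symmetric R -> (forall s a, a \in X s -> #|[set b | R a b]| <= D) ->
  (forall s, #|S| * D.+1 < #|X s|) ->
  exists f : S -> T, (forall s, f s \in X s) /\
    (forall s s', s != s' -> f s != f s' /\ ~~ R (f s) (f s')).
Proof.
move=> Rsym degX bigX.
have X0 s : exists a, a \in X s.
  by apply/set0Pn; rewrite -card_gt0; apply: leq_ltn_trans (bigX s).
pose f0 s := xchoose (X0 s).
have f0X s : f0 s \in X s by exact: xchooseP.
have step (l : seq S) : uniq l -> exists f : S -> T, (forall s, f s \in X s) /\
    {in l &, forall s s', s != s' -> f s != f s' /\ ~~ R (f s) (f s')}.
  elim: l => [_|s l IHl]; first by exists f0; split.
  move=> /andP[s_l /[dup] ul /IHl[f [fX fR]]].
  pose B := \bigcup_(t in l) (f t |: [set b | R (f t) b]).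
  have ltB : #|B| < #|X s|.
    apply: leq_ltn_trans (bigX s); apply: leq_trans (leq_card_bigcup _ _) _.
    apply: (@leq_trans (\sum_(t in l) D.+1)).
      apply: leq_sum => t _; apply: leq_trans (leq_card_setU _ _) _.
      by rewrite cards1 add1n ltnS (degX t).
    by rewrite sum_nat_const leq_mul2r max_card orbT.
  have /subsetPn[a aX aB] : ~~ (X s \subset B).
    by apply/negP => /subset_leq_card; rewrite leqNgt ltB.
  have aP t : t \in l -> f t != a /\ ~~ R (f t) a.
    move=> tl; split; apply: contraNN aB => H; apply/bigcupP; exists t => //.
      by rewrite !inE eq_sym H.
    by rewrite !inE H orbT.
  exists (fun t => if t == s then a else f t); split.
    by move=> t; case: eqP => // ->.
  move=> t t'; rewrite !inE; case: (eqVneq t s) => [->|ts]; case: (eqVneq t' s) => [->|ts'] //=.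
  - by move=> _ t'l _; have [] := aP t' t'l; rewrite eq_sym Rsym.
  - by move=> tl _ _; exact: aP.
  - exact: fR.
have [f [fX fR]] := step (enum S) (enum_uniq _).
by exists f; split => // s s'; apply: fR; rewrite mem_enum.
Qed.

Lemma subset_of_card (T : finType) (A : {set T}) n : n <= #|A| ->
  exists2 B : {set T}, B \subset A & #|B| = n.
Proof.
move=> /card_geqP[s [us ss sA]]; exists [set x in s].
  by apply/subsetP => x; rewrite inE => /sA.
by rewrite cardsE -ss; apply/card_uniqP.
Qed.

Lemma superset_of_card (T : finType) (A : {set T}) n : #|A| <= n <= #|T| ->
  exists2 B : {set T}, A \subset B & #|B| = n.
Proof.
move=> /andP[An nT]; have [|C sC cC] := @subset_of_card T (~: A) (n - #|A|).
  by rewrite leq_subLR cardsC.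
exists (A :|: C); first exact: subsetUl.
rewrite cardsU; have -> : A :&: C = set0.
  by apply/eqP; rewrite setI_eq0 disjoint_sym disjoints_subset.
rewrite cards0 cC subn0; lia.
Qed.

(** The converse of Markov's inequality for a bounded function: a mean of at
least twice t / h cannot come from values below t / h, so the values above it
carry half of the sum. *)
Lemma large_part_card (T : finType) (X : {set T}) (r : T -> nat) t h M :
  (forall a, a \in X -> r a <= M) -> 2 * t * #|X| <= h * \sum_(a in X) r a ->
  t * #|X| <= h * M * #|[set a in X | t <= h * r a]|.
Proof.
move=> rM lem; set X1 := [set a in X | _].
have s1 : h * \sum_(a in X) r a <= h * M * #|X1| + t * #|X|.
  have -> : h * M * #|X1| = \sum_(a in X) h * M * (t <= h * r a).
    rewrite mulnC -sum_nat_const; under eq_bigl => a do rewrite inE.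
    by rewrite big_mkcondr /=; apply: eq_bigr => a _; case: ifP; rewrite ?muln1 ?muln0.
  rewrite [t * _]mulnC -sum_nat_const -big_split big_distrr /=; apply: leq_sum => a aX.
  case: (leqP t (h * r a)) => H; last by apply: leq_trans (ltnW H) (leq_addl _ _).
  by rewrite muln1; apply: leq_trans (leq_addr _ _); rewrite leq_mul2l rM ?orbT.
move: lem s1; rewrite -mulnA mul2n -addnn; lia.
Qed.

Lemma markov_card (T : finType) (X : {set T}) (r : T -> nat) t :
  t * #|[set a in X | t <= r a]| <= \sum_(a in X) r a.
Proof.
rewrite mulnC -sum_nat_const; under eq_bigl => a do rewrite inE.
by rewrite big_mkcondr /=; apply: leq_sum => a _; case: ifP.
Qed.

(** * Degree sums, sparsity and orientations *)

Section DegreeSums.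
Variable G : sgraph.
Implicit Types (x y a b : G) (S U M : {set G}).

Definition nbhd x S := [set y in S | adj x y].
(** Twice the number of edges spanned by S. *)
Definition degsum S := \sum_(x in S) #|nbhd x S|.

(** As adjacency is irreflexive, the closed walks of length four that are
degenerate in this sense are exactly those that do not trace a 4-cycle. *)
Definition no_C4 S := forall x y z w : G, x \in S -> y \in S -> z \in S -> w \in S ->
  adj x y -> adj y z -> adj z w -> adj w x -> x = z \/ y = w.

(** Average degree at least k, with the division cleared. *)
Definition C4_free_dense k :=
  exists S, [/\ S != set0, no_C4 S & k * #|S| <= degsum S].

Lemma nbhd_sub x S : nbhd x S \subset S.
Proof. by apply/subsetP => y; rewrite inE => /andP[]. Qed.

Lemma nbhdS x S U : S \subset U -> nbhd x S \subset nbhd x U.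
Proof.
by move=> /subsetP sSU; apply/subsetP => y; rewrite !inE => /andP[/sSU -> ->].
Qed.

Lemma degsum_pairs S :
  degsum S = \sum_(x in S) \sum_(y in S) (adj x y : nat).
Proof.
apply: eq_bigr => x _; rewrite -sum1dep_card big_mkcondr /=.
by apply: eq_bigr => y _; case: adj.
Qed.

Lemma degsumS S U : S \subset U -> degsum S <= degsum U.
Proof.
move=> sSU; rewrite /degsum [leqRHS](big_setID S) /= (setIidPr sSU).
apply: leq_trans (leq_addr _ _); apply: leq_sum => x _.
exact/subset_leq_card/nbhdS.
Qed.

Lemma degsumD1 S x : x \in S -> degsum S = degsum (S :\ x) + (#|nbhd x S|).*2.
Proof.
move=> xS; rewrite /degsum (big_setD1 x) //= -addnn [RHS]addnA addnC; congr (_ + _).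
have -> : \sum_(i in S :\ x) #|nbhd i S|
   = \sum_(i in S :\ x) (#|nbhd i (S :\ x)| + (adj x i : nat)).
  apply: eq_bigr => i _; rewrite (cardsD1 x (nbhd i S)) addnC; congr (_ + _).
    by apply: eq_card => j; rewrite !inE andbA.
  by rewrite inE xS adj_sym.
rewrite big_split /=; congr (_ + _).
rewrite -sum1_card [RHS](eq_bigl (fun i => (i \in S :\ x) && adj x i)).
  by rewrite [RHS]big_mkcondr /=; apply: eq_bigr => i _; case: adj.
by move=> i; rewrite !inE; case: eqP => // ->; rewrite adj_irr andbF.
Qed.

Lemma bipartite_degsum S U k : [disjoint S & U] ->
  (forall a, a \in S -> k <= #|nbhd a U|) -> 2 * k * #|S| <= degsum (S :|: U).
Proof.
move=> dSU degS.
have sumS : k * #|S| <= \sum_(a in S) \sum_(b in U) (adj a b : nat).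
  rewrite mulnC -sum_nat_const; apply: leq_sum => a aS.
  apply: leq_trans (degS a aS) _; rewrite -sum1dep_card big_mkcondr /=.
  by apply: leq_sum => b _; case: adj.
rewrite degsum_pairs (big_setID S) /= setIUl setIid.
have -> : S :|: U :&: S = S by apply/setUidPl; exact: subsetIr.
have -> : (S :|: U) :\: S = U.
  rewrite setDUl setDv set0U; apply/setDidPl; by rewrite disjoint_sym.
rewrite -mulnA mul2n -addnn; apply: leq_add.
  apply: leq_trans sumS _; apply: leq_sum => a _.
  by rewrite [leqRHS](big_setID U) /= [S :|: U]setUC setUK leq_addr.
apply: leq_trans sumS _; rewrite exchange_big /=; apply: leq_sum => b _.
rewrite [leqRHS](big_setID S) /= setUK.
by apply: leq_trans (leq_addr _ _); apply: leq_sum => a _; rewrite adj_sym.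
Qed.

(** A 4-cycle in A :|: V alternates between the two independent sides, so two
points of A would share two neighbours. There are at least k #|A| edges on at
most 2 #|A| vertices. *)
Lemma linear_design_C4_free_dense k (A V : {set G}) :
  [disjoint A & V] -> 0 < #|V| <= #|A| ->
  {in A &, forall a a', ~~ adj a a'} -> {in V &, forall b b', ~~ adj b b'} ->
  (forall a, a \in A -> k <= #|nbhd a V|) ->
  (forall a a', a \in A -> a' \in A -> a != a' -> #|nbhd a V :&: nbhd a' V| <= 1) ->
  C4_free_dense k.
Proof.
move=> dAV /andP[V0 leVA] indA indV degA lin; exists (A :|: V); split.
- by rewrite -card_gt0; apply: leq_trans V0 (subset_leq_card (subsetUr _ _)).
- have lin' a b a' b' : a \in A -> b \in V -> a' \in A -> b' \in V ->
      adj a b -> adj b a' -> adj a' b' -> adj b' a -> a = a' \/ b = b'.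
    move=> aA bV a'A b'V ab ba' a'b' b'a; case: (eqVneq a a') => [->|/lin]; first by left.
    move=> /(_ aA a'A); case: (eqVneq b b') => [->|nb]; first by right.
    have /subset_leq_card : [set b; b'] \subset nbhd a V :&: nbhd a' V.
      by apply/subsetP => c; rewrite !inE => /orP[] /eqP->;
         rewrite ?bV ?b'V ?ab ?a'b' ?(adj_sym a b') ?(adj_sym a' b) ?b'a ?ba'.
    by rewrite cards2 nb => /leq_trans H /H.
  have alt x y : x \in A :|: V -> y \in A :|: V -> adj x y ->
      (x \in A) && (y \in V) || (x \in V) && (y \in A).
    rewrite !inE => /orP[] xX /orP[] yX xy; rewrite ?xX ?yX ?orbT //.
    + by move: (indA _ _ xX yX); rewrite xy.
    + by move: (indV _ _ xX yX); rewrite xy.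
  have AV x : x \in A -> x \in V -> False by move=> /(disjointFr dAV) ->.
  move=> x y z w xS yS zS wS xy yz zw wx.
  have [] := (orP (alt _ _ xS yS xy), orP (alt _ _ yS zS yz), orP (alt _ _ zS wS zw)).
  case=> -[] /andP[x1 y1] [] /andP[y2 z1] [] /andP[z2 w1] //; try by exfalso; eauto.
  + exact: lin'.
  + have [->|->] := lin' y z w x y1 z1 w1 x1 yz zw wx xy; by [right | left].
- apply: leq_trans (bipartite_degsum dAV degA).
  rewrite mulnAC [2 * _]mulnC mulnC leq_mul2r; apply/orP; right.
  rewrite muln2 -addnn; apply: leq_trans (leq_card_setU _ _) _.
  by rewrite leq_add2l.
Qed.

(** Deleting a vertex of minimum degree does not decrease the density
degsum U / (#|U| #|U|.-1). *)
Lemma shrink_keeps_density U d : 1 < d -> d <= #|U| ->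
  exists U', [/\ U' \subset U, #|U'| = d &
    degsum U * (d * d.-1) <= degsum U' * (#|U| * #|U|.-1)].
Proof.
move=> d1 dU; move: {2}(#|U| - d) (leqnn (#|U| - d)) => m.
elim: m U dU => [|m IHm] U dU lem.
  by exists U; split => //; have -> : d = #|U| by lia.
have [<-|ltdU] := eqVneq #|U| d; first by exists U; split.
have {}ltdU : d < #|U| by lia.
have /card_gt0P[x0 x0U] : 0 < #|U| by lia.
case: (arg_minnP (fun x => #|nbhd x U|) x0U) => v vU minv.
have {}vU : v \in U by exact: vU.
have cU : #|U :\ v| = #|U|.-1 by move: (cardsD1 v U); rewrite vU; lia.
have avg : #|U| * #|nbhd v U| <= degsum U.
  by rewrite -sum_nat_const; exact: leq_sum.
have [|| U' [sU' cU' lU']] := IHm (U :\ v); [by lia..|].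
exists U'; split => //; first by apply: subset_trans sU' (subsetDl _ _).
move: lU' avg; rewrite (degsumD1 vU) cU.
move: (degsum _) (degsum _) #|nbhd _ _| => s s' f; set u := #|U| in ltdU *.
case: u ltdU => [|[|u]] ltdU; [lia|lia|rewrite /= => H1 H2].
have u0 : 0 < u by lia.
have H3 : u * f <= s' by lia.
rewrite -(leq_pmul2l u0).
apply: (@leq_trans (u.+2 * (s' * (d * d.-1)))).
  rewrite !mulnA -!mulnA mulnA [u.+2 * _]mulnA leq_mul2r; apply/orP; right; nia.
apply: leq_trans (leq_mul (leqnn u.+2) H1) _; apply: eq_leq; nia.
Qed.

(** A denser U would contain, or be contained in, a set of exactly d vertices
that is too dense. *)
Lemma local_sparsity N d L U : 1 < d -> d <= #|G| ->
  (forall W : {set G}, #|W| = d -> N * degsum W < d ^ 2) ->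
  0 < L -> #|U| <= L * d -> N * degsum U <= 2 * L ^ 2 * d ^ 2.
Proof.
move=> d1 dG sparse L0 leU; case: (leqP d #|U|) => dU.
  have [U' [_ cU' lU']] := shrink_keeps_density d1 dU.
  have := sparse U' cU'; move: leU lU'.
  move: (degsum _) (degsum _) #|U| => s s' u leu H1 H2.
  have uu : u * u.-1 <= L ^ 2 * d ^ 2.
    by rewrite -expnMn expnS expn1; apply: leq_mul => //; apply: leq_trans leu; exact: leq_pred.
  have D0 : 0 < d * d.-1 by rewrite muln_gt0; lia.
  have D1 : d ^ 2 <= 2 * (d * d.-1) by nia.
  rewrite -(leq_pmul2r D0) -mulnA.
  apply: leq_trans (leq_mul (leqnn N) H1) _.
  apply: (@leq_trans (d ^ 2 * (L ^ 2 * d ^ 2))).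
    by rewrite mulnA; apply: leq_mul => //; exact: ltnW.
  by rewrite mulnC -!mulnA; nia.
have [W sUW cW] : exists2 W : {set G}, U \subset W & #|W| = d.
  by apply: superset_of_card; rewrite (ltnW dU).
apply: leq_trans (leq_mul (leqnn N) (degsumS sUW)) _.
apply: leq_trans (ltnW (sparse W cW)) _.
by rewrite leq_pmull // muln_gt0 expn_gt0 L0.
Qed.

(** Remove vertices of small remaining degree one at a time and orient every
edge away from the endpoint that is removed first. *)
Lemma bounded_orientation D (S : {set G}) :
  (forall U, U \subset S -> U != set0 -> exists2 x, x \in U & #|nbhd x U| <= D) ->
  exists out : G -> {set G},
    [/\ forall a, a \in S -> out a \subset nbhd a S,
        forall a, a \in S -> #|out a| <= D &
        forall a b, a \in S -> b \in S -> adj a b -> b \in out a \/ a \in out b].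
Proof.
move: {2}#|S| (erefl #|S|) => m; elim: m S => [|m IHm] S cS degen.
  exists (fun=> set0); have -> : S = set0 by apply/eqP; rewrite -cards_eq0 cS.
  by split => [a|a|a b]; rewrite ?inE.
have S0 : S != set0 by rewrite -card_gt0 cS.
have [v vS degv] := degen S (subxx S) S0.
have [||out [outS outD outT]] := IHm (S :\ v).
- by move: (cardsD1 v S); rewrite vS cS; lia.
- by move=> U sU; apply: degen; apply: subset_trans sU (subsetDl _ _).
exists (fun a => if a == v then nbhd v S else out a); split.
- move=> a aS; case: (eqVneq a v) => [->|av] //.
  apply: subset_trans (outS a _) (nbhdS _ (subsetDl _ _)).
  by rewrite !inE av.
- move=> a aS; case: (eqVneq a v) => [_|av] //.
  by apply: outD; rewrite !inE av.
- move=> a b aS bS ab; case: (eqVneq a v) => [av|av].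
    by left; rewrite inE bS -av.
  case: (eqVneq b v) => [bv|bv]; first by right; rewrite inE aS -bv adj_sym.
  by apply: outT => //; rewrite !inE ?av ?bv.
Qed.

End DegreeSums.

(** * A random colour class that sees exactly a good tuple *)

(** Bernoulli's inequality (1 - 1/d) ^ m >= 1 - m/d. *)
Lemma bernoulli_pred d m : m <= d -> d ^ m * (d - m) <= d.-1 ^ m * d.
Proof.
elim: m => [|m IHm] md; first by rewrite !expn0 !mul1n subn0.
have {}IHm := IHm (ltnW md).
rewrite !expnS -mulnA [_ * (d.-1 ^ m) * d]mulnAC.
apply: (@leq_trans (d.-1 * (d ^ m * (d - m)))); last first.
  by rewrite -[leqRHS]mulnA leq_mul2l [d * _]mulnC IHm orbT.
rewrite mulnCA [leqRHS]mulnCA leq_mul2l; apply/orP; right; nia.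
Qed.

(** The factor (1 - 1/d) ^ x is at least 8 ^ -C: by Bernoulli d./2 factors lose
at most a factor 2, and C d is at most 3 C such blocks. *)
Lemma exp_pred_lower d C x : 1 < d -> x <= C * d -> d ^ x <= 8 ^ C * d.-1 ^ x.
Proof.
(* A block of d./2 factors loses at most a factor 2. *)
move=> d1 xC; pose m := d./2.
have half : d ^ m <= 2 * d.-1 ^ m.
  have md : m <= d by rewrite /m; lia.
  have dm : 0 < d - m by rewrite /m; lia.
  rewrite -(leq_pmul2r dm); apply: leq_trans (bernoulli_pred md) _.
  rewrite [2 * _]mulnC -mulnA leq_mul2l; apply/orP; right; rewrite /m; lia.
have d3 : d <= 3 * m by rewrite /m; lia.
have xy : x <= m * (3 * C) by move: (leq_mul (leqnn C) d3); lia.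
have d0 : 0 < d.-1 ^ (m * (3 * C) - x) by rewrite expn_gt0; lia.
rewrite -(leq_pmul2r d0) -mulnA -expnD (subnKC xy).
apply: (@leq_trans (d ^ (m * (3 * C)))).
  rewrite -{2}(subnKC xy) expnD leq_mul2l; apply/orP; right.
  by case: (_ - x) => // z; rewrite leq_exp2r // leq_pred.
have -> : 8 ^ C = 2 ^ (3 * C) by rewrite expnM.
rewrite (expnM d m) (expnM d.-1 m) -expnMn.
by case: (3 * C) => // z; rewrite leq_exp2r.
Qed.

Section Oriented.
Variables (G : sgraph) (d : nat) (S0 : {set G}) (out : G -> {set G}).
Hypothesis d_gt1 : 1 < d.
Hypothesis out_nbhd : forall a, a \in S0 -> out a \subset nbhd a S0.
Hypothesis out_le : forall a, a \in S0 -> #|out a| <= 2 * d.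
Hypothesis out_total : forall a b, a \in S0 -> b \in S0 -> adj a b ->
  b \in out a \/ a \in out b.
Implicit Types (a b : G) (X B V : {set G}).

Definition low_degree C X := forall a, a \in X -> #|nbhd a S0| <= C * d.

Definition tuple_image k (t : {ffun 'I_k -> G}) : {set G} := t @: 'I_k.

Section RandomClass.
Variables (k c1 : nat) (X B : {set G}) (good : G -> pred {ffun 'I_k -> G}).
Hypothesis X_S0 : X \subset S0.
Hypothesis X_low : low_degree 64 X.
Hypothesis B_S0 : B \subset S0.
Hypothesis good_inj : forall a t, a \in X -> good a t -> injective t.
Hypothesis good_nbhd : forall a t, a \in X -> good a t -> tuple_image t \subset nbhd a B.
Hypothesis good_indep : forall a t, a \in X -> good a t ->
  forall i j, ~~ adj (t i) (t j).
Hypothesis good_many : forall a, a \in X -> d ^ k <= c1 * #|[set t | good a t]|.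

Let c0 : 'I_d := Ordinal (ltnW d_gt1).
Let class (f : {ffun G -> 'I_d}) := [set b in B | f b == c0].
Let isolated (f : {ffun G -> 'I_d}) := [set b in class f | [disjoint out b & class f]].
Let kept (f : {ffun G -> 'I_d}) := [set a in X | (f a != c0) &&
  [exists t, good a t && (nbhd a (isolated f) == tuple_image t)]].

Let forbidden a (t : {ffun 'I_k -> G}) :=
  (a |: nbhd a S0 :|: \bigcup_(b in tuple_image t) out b) :\: tuple_image t.
Let event a t := [set f : {ffun G -> 'I_d} |
  [forall x in tuple_image t, f x == c0] && [forall x in forbidden a t, f x != c0]].

(** The event asks for colour c0 on the tuple t, and for other colours on a, on
the other neighbours of a and on the out-neighbours of t. So every entry of t
is isolated in its class, and a has no neighbour in the class outside t. *)
Lemma event_kept a t f : a \in X -> good a t -> f \in event a t ->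
  a \in kept f /\ nbhd a (isolated f) = tuple_image t.
Proof.
move=> aX gat; rewrite inE => /andP[/forall_inP fZ /forall_inP fW].
have tB : {subset tuple_image t <= B}.
  move=> x /(subsetP (good_nbhd aX gat)); by rewrite inE => /andP[].
have at_ x : x \in tuple_image t -> adj a x.
  by move=> /(subsetP (good_nbhd aX gat)); rewrite inE => /andP[].
have ncls x : x \in forbidden a t -> x \notin class f.
  by move=> /fW H; rewrite inE negb_and H orbT.
have tcls x : x \in tuple_image t -> x \in class f.
  by move=> xt; rewrite inE (tB x xt) fZ.
have eqN : nbhd a (isolated f) = tuple_image t.
  apply/setP => x; apply/idP/idP => [|xt].
    rewrite inE => /andP[]; rewrite inE => /andP[xc _] ax.
    apply: contraLR (xc) => xt; apply: ncls; move: xc; rewrite !inE xt ax andbT => /andP[xB _].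
    by rewrite (subsetP B_S0 x xB) orbT.
  rewrite inE at_ // andbT inE tcls //= disjoint_subset; apply/subsetP => y yo.
  apply: ncls; rewrite !inE; apply/andP; split; last first.
    by apply/orP; right; apply/bigcupP; exists x.
  have xS : x \in S0 by apply: (subsetP B_S0); exact: tB.
  move: (subsetP (out_nbhd xS) y yo); rewrite inE => /andP[_ xy].
  case/imsetP: xt => i _ ex; apply/negP => /imsetP[j _ ey].
  by move: (good_indep aX gat i j); rewrite -ex -ey xy.
split=> //; rewrite inE aX /=; apply/andP; split.
  apply: fW; rewrite !inE eqxx /= andbT.
  by apply/negP => /at_; rewrite adj_irr.
by apply/existsP; exists t; rewrite gat eqN eqxx.
Qed.

Lemma card_tuple_image a t : a \in X -> good a t -> #|tuple_image t| = k.
Proof.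
by move=> aX gat; rewrite card_imset ?card_ord //; exact: good_inj aX gat.
Qed.

Lemma forbidden_le a t : a \in X -> good a t -> 0 < k ->
  #|forbidden a t| <= (65 + 2 * k) * d.
Proof.
move=> aX gat k0; apply: leq_trans (subset_leq_card (subsetDl _ _)) _.
apply: leq_trans (leq_card_setU _ _) _.
apply: (@leq_trans ((1 + 64 * d) + k * (2 * d))); last lia.
apply: leq_add.
  apply: leq_trans (leq_card_setU _ _) _; rewrite cards1 leq_add2l.
  exact: X_low.
apply: leq_trans (leq_card_bigcup _ _) _.
rewrite -{2}(card_tuple_image aX gat) -sum_nat_const; apply: leq_sum => b bt.
apply: out_le; apply: (subsetP B_S0).
by move: (subsetP (good_nbhd aX gat) b bt); rewrite inE => /andP[].
Qed.

Lemma event_large a t : a \in X -> good a t -> 0 < k ->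
  d ^ #|G| <= 8 ^ (65 + 2 * k) * (#|event a t| * d ^ k).
Proof.
move=> aX gat k0.
have dis : [disjoint tuple_image t & forbidden a t].
  by rewrite disjoint_sym disjoints_subset; apply/subsetP => x; rewrite !inE => /andP[].
have := card_colourings c0 dis; rewrite (card_tuple_image aX gat) -/(event a t).
have := exp_pred_lower d_gt1 (forbidden_le aX gat k0).
move: #|forbidden a t| => w Hw Hc.
have dw : 0 < d ^ w by rewrite expn_gt0 (ltnW d_gt1).
rewrite -(leq_pmul2r dw); apply: leq_trans (leq_mul (leqnn _) Hw) _.
rewrite -mulnA -[_ * d ^ k * d ^ w]mulnA -expnD Hc.
by apply: eq_leq; rewrite mulnCA; congr (_ * _); rewrite mulnC.
Qed.

(** Whenever the event holds, the image of t is the set of isolated vertices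
that a sees, so at most k ^ k tuples t qualify. *)
Lemma kept_large f a : a \in X ->
  \sum_(t | good a t) (f \in event a t : nat) <= k ^ k * (a \in kept f).
Proof.
move=> aX; case: (boolP [exists t, good a t && (f \in event a t)]); last first.
  move=> /existsPn H; rewrite big1 // => t gat; move: (H t); rewrite gat /=.
  by case: (_ \in _).
case/existsP => t0 /andP[g0 f0]; have [ka eqN] := event_kept aX g0 f0.
rewrite ka muln1; set Z := tuple_image t0 in eqN.
apply: (@leq_trans (\sum_(t : {ffun 'I_k -> G} | t \in ffun_on (mem Z)) 1)).
  rewrite big_mkcond [leqRHS]big_mkcond /=; apply: leq_sum => t _.
  case: ifP => // gat; case: (boolP (f \in event a t)) => //= ft.
  have [_ eqN'] := event_kept aX gat ft.
  case: ifP => // /negP[]; apply/ffun_onP => i; suff : t i \in Z by [].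
  by rewrite -eqN eqN'; exact: imset_f.
by rewrite sum1_card card_ffun_on card_ord cardE -cardE (card_tuple_image aX g0).
Qed.

Lemma kept_sum : 0 < k ->
  #|X| * d ^ #|G| <= (8 ^ (65 + 2 * k) * c1 * k ^ k) *
     \sum_(f : {ffun G -> 'I_d}) #|kept f|.
Proof.
move=> k0; have dk : 0 < d ^ k by rewrite expn_gt0 (ltnW d_gt1).
have := fun a t aX gat => @event_large a t aX gat k0.
move: (8 ^ _) => e large; rewrite -(leq_pmul2r dk).
have key : \sum_(a in X) \sum_(t | good a t) #|event a t|
   <= k ^ k * \sum_(f : {ffun G -> 'I_d}) #|kept f|.
  apply: (@leq_trans (\sum_(f : {ffun G -> 'I_d}) \sum_(a in X) \sum_(t | good a t)
      (f \in event a t : nat))).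
    rewrite [leqRHS]exchange_big /=; apply: leq_sum => a _.
    rewrite [leqRHS]exchange_big /=; apply: leq_sum => t _.
    by rewrite -sum1_card big_mkcond /=; apply: leq_sum => f _; case: ifP.
  rewrite big_distrr /=; apply: leq_sum => f _.
  apply: (@leq_trans (\sum_(a in X) k ^ k * (a \in kept f))).
    by apply: leq_sum => a aX; exact: kept_large.
  rewrite -big_distrr /= leq_mul2l; apply/orP; right.
  rewrite -sum1_card [leqRHS]big_mkcond /= big_mkcond /=; apply: leq_sum => a _.
  by case: (_ \in X) => //; case: ifP.
apply: (@leq_trans (\sum_(a in X) c1 * (e * (d ^ k * \sum_(t | good a t) #|event a t|)))).
  rewrite -mulnA -sum_nat_const; apply: leq_sum => a aX.
  rewrite mulnC; apply: leq_trans (leq_mul (good_many aX) (leqnn _)) _.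
  rewrite -mulnA leq_mul2l; apply/orP; right.
  rewrite big_distrr big_distrr /= cardsE -sum_nat_const; apply: leq_sum => t gat.
  by rewrite [d ^ k * _]mulnC; exact: large.
rewrite -!big_distrr /=; move: key; move: (\sum_(a in X) _) (\sum_f _) => s1 s2 key.
apply: (@leq_trans (c1 * (e * (d ^ k * (k ^ k * s2))))).
  by rewrite !leq_mul2l key !orbT.
by apply: eq_leq; move: (k ^ k) (d ^ k) => y z; lia.
Qed.

Lemma class_sum : d * (\sum_(f : {ffun G -> 'I_d}) #|class f|) = #|B| * d ^ #|G|.
Proof.
have -> : \sum_(f : {ffun G -> 'I_d}) #|class f| = \sum_(b in B)
    #|[set f : {ffun G -> 'I_d} | [forall x in [set b], f x == c0]]|.
  transitivity (\sum_(f : {ffun G -> 'I_d}) \sum_(b in B) (f b == c0 : nat)).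
    apply: eq_bigr => f _; rewrite -sum1dep_card big_mkcondr /=.
    by apply: eq_bigr => b _; case: eqP.
  rewrite exchange_big /=; apply: eq_bigr => b _.
  rewrite -sum1dep_card [RHS]big_mkcond /=; apply: eq_bigr => f _.
  have -> : [forall x in [set b], f x == c0] = (f b == c0).
    apply/forall_inP/idP => [|fb x]; first by apply; rewrite inE.
    by rewrite inE => /eqP ->.
  by case: eqP.
rewrite big_distrr /= -sum_nat_const; apply: eq_bigr => b _.
by rewrite -(card_colourings0 c0 [set b]) cards1 expn1 mulnC.
Qed.

(** Colour the vertices with d colours. The class of c0 has on average #|B| / d
elements in B. Every good tuple t of a is, with probability of order d ^ -k, what
a sees of the class; there are at least d ^ k / c1 of them, so a is kept with
probability bounded below. Dropping the vertices of the class that have an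
out-neighbour in the class makes V independent. *)
Lemma random_class K e : 0 < k -> 8 ^ (65 + 2 * k) * c1 * k ^ k <= e ->
  e * (K * #|B|) < #|X| ->
  exists A V : {set G}, [/\ A \subset X, V \subset B, [disjoint A & V],
    {in V &, forall b b', ~~ adj b b'} & K * d * #|V| < #|A| /\
    forall a, a \in A -> exists2 t, good a t & nbhd a V = tuple_image t].
Proof.
move=> k0; have := kept_sum k0; move: (8 ^ _ * _ * _) => e' sum_le' le_e big.
have sum_le := leq_trans sum_le' (leq_mul le_e (leqnn _)).
have [f hf] : exists f, K * d * #|class f| < #|kept f|.
  apply/existsP; apply: contraLR big => /existsPn H; rewrite -leqNgt.
  have d0 : 0 < d ^ #|G| by rewrite expn_gt0 (ltnW d_gt1).
  rewrite -(leq_pmul2r d0); apply: leq_trans sum_le _.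
  rewrite -mulnA leq_mul2l -mulnA -class_sum; apply/orP; right.
  rewrite mulnA big_distrr /=; apply: leq_sum => f _.
  by move: (H f); rewrite -leqNgt.
exists (kept f), (isolated f); split.
- by apply/subsetP => a; rewrite inE => /andP[].
- by apply/subsetP => b; rewrite !inE => /andP[/andP[]].
- by rewrite disjoints_subset; apply/subsetP => a; rewrite !inE => /and3P[_ /negPf->]; rewrite andbF.
- move=> b b'; rewrite inE => /andP[bc bd]; rewrite inE => /andP[b'c b'd].
  apply/negP => bb'.
  have bS : b \in S0 by apply: (subsetP B_S0); move: bc; rewrite inE => /andP[].
  have b'S : b' \in S0 by apply: (subsetP B_S0); move: b'c; rewrite inE => /andP[].
  case: (out_total bS b'S bb') => H.
    by rewrite (disjointFr bd H) in b'c.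
  by rewrite (disjointFr b'd H) in bc.
- split.
    apply: leq_ltn_trans hf; rewrite leq_mul2l; apply/orP; right.
    by apply: subset_leq_card; apply/subsetP => b; rewrite inE => /andP[].
  move=> a; rewrite inE => /and3P[_ _ /existsP[t /andP[gat /eqP eqN]]].
  by exists t.
Qed.

End RandomClass.
End Oriented.

(** * Dead stars *)

Section Stars.
Variables (G : sgraph) (out : G -> {set G}).
Implicit Types (X : {set G}).

Definition star X b := [set a in X | b \in out a].
Definition cnt X (P : pred G) := \sum_(a in X) #|[set b in out a | P b]|.

Lemma star_exchange X (P : pred G) (F : G -> G -> nat) :
  \sum_(a in X) \sum_(b in [set b in out a | P b]) F a b
   = \sum_(b | P b) \sum_(a in star X b) F a b.
Proof.
rewrite (exchange_big_dep P) /=; last by move=> a b _; rewrite inE => /andP[].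
apply: eq_bigr => b Pb; apply: eq_bigl => a; by rewrite !inE Pb andbT.
Qed.

Lemma cnt_star X (P : pred G) : cnt X P = \sum_(b | P b) #|star X b|.
Proof.
under [RHS]eq_bigr => b _ do rewrite -sum1_card.
by rewrite -(star_exchange X P (fun _ _ => 1)); apply: eq_bigr => a _; rewrite sum1_card.
Qed.

Lemma star_sub X b : star X b \subset X.
Proof. by apply/subsetP => a; rewrite inE => /andP[]. Qed.

End Stars.

Section DeadPairs.
Variables (G : sgraph) (N d : nat) (S0 : {set G}) (out : G -> {set G}).
Hypothesis d_gt1 : 1 < d.
Hypothesis sparse : forall L (U : {set G}), 0 < L -> #|U| <= L * d ->
  N * degsum U <= 2 * L ^ 2 * d ^ 2.
Hypothesis out_nbhd : forall a, a \in S0 -> out a \subset nbhd a S0.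
Hypothesis out_le : forall a, a \in S0 -> #|out a| <= 2 * d.
Hypothesis out_total : forall a b, a \in S0 -> b \in S0 -> adj a b ->
  b \in out a \/ a \in out b.
Implicit Types (a b : G) (Y : {set G}).

(** In units of d, Y is large, but only a fraction 1 / g' of its out-edges, on the
scale of d out-edges per point, lead to vertices with many in-neighbours in Y. *)
Definition dead w w' g' Y := (w * d <= #|Y|) &&
  (g' * cnt out Y (fun b => w' * d <= #|star out Y b|) < d * #|Y|).

Variables (k g g' w w' : nat) (X : {set G}).
Hypothesis k_gt0 : 0 < k.
Hypothesis g_gt0 : 0 < g.
Hypothesis X_S0 : X \subset S0.
Hypothesis X_low : low_degree d S0 64 X.
Hypothesis X_gt0 : 0 < #|X|.
Hypothesis N_large : 64 * 64 * g ^ 2 * k ^ 2 <= N.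
Hypothesis g'_large : 128 * 128 * g ^ 3 * k ^ 2 <= g'.
Hypothesis d_large : 32 * g * k ^ 2 <= d.
Hypothesis many_dead :
  d * #|X| <= 2 * g * cnt out X (fun b => dead w w' g' (star out X b)).

Let isdead b := dead w w' g' (star out X b).
Let dead_out a := [set b in out a | isdead b].
Let dead_set := [set b in S0 | isdead b].
Let heavy b b' := w' * d <= #|star out (star out X b) b'|.
Let clash b b' := heavy b b' || adj b b'.
Let sigma := 32 * g * k ^ 2.

Let XS a : a \in X -> a \in S0. Proof. exact: (subsetP X_S0). Qed.

Lemma card_dead_out a : a \in X -> #|dead_out a| <= 2 * d.
Proof.
move=> aX; apply: leq_trans (out_le (XS aX)); apply: subset_leq_card.
by apply/subsetP => b; rewrite inE => /andP[].
Qed.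

(** The stars of the dead vertices are large, and every point of X lies in at most
2 d of them. *)
Lemma few_dead : w * #|dead_set| <= 2 * #|X|.
Proof.
rewrite -(leq_pmul2l (ltnW d_gt1)).
apply: (@leq_trans (cnt out X isdead)).
  rewrite cnt_star; apply: (@leq_trans (\sum_(b in dead_set) #|star out X b|)).
    rewrite mulnA mulnC -sum_nat_const; apply: leq_sum => b.
    by rewrite inE mulnC => /andP[_ /andP[]].
  rewrite big_mkcond [leqRHS]big_mkcond; apply: leq_sum => b _.
  by rewrite inE; case: (isdead b); case: (b \in S0).
by rewrite mulnCA mulnA mulnC -sum_nat_const; apply: leq_sum => a; exact: card_dead_out.
Qed.

Let busy := [set a in X | d <= 4 * g * #|dead_out a|].

Lemma many_busy : #|X| <= 8 * g * #|busy|.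
Proof.
rewrite -(leq_pmul2l (ltnW d_gt1)).
have := @large_part_card _ X (fun a => #|dead_out a|) d (4 * g) (2 * d) card_dead_out.
rewrite -/busy => H; apply: leq_trans (H _) _; last by apply: eq_leq; lia.
rewrite -mulnA; apply: leq_trans (leq_mul (leqnn 2) many_dead) _.
by rewrite /cnt; apply: eq_leq; rewrite !mulnA.
Qed.

Let heavy_pairs a := \sum_(b in dead_out a) #|[set b' in out a | heavy b b']|.

(** For each dead b, the out-edges from the star of b to vertices b' with a large
common star are few; summing over b counts the pairs (b, b') below every a. *)
Lemma heavy_pairs_sum : g' * \sum_(a in X) heavy_pairs a <= 2 * d ^ 2 * #|X|.
Proof.
rewrite /heavy_pairs /dead_out star_exchange big_distrr /=.
apply: (@leq_trans (\sum_(b | isdead b) d * #|star out X b|)).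
  by apply: leq_sum => b /andP[_ /ltnW].
have le_cnt : cnt out X isdead <= #|X| * (2 * d).
  by rewrite -sum_nat_const; apply: leq_sum => a; exact: card_dead_out.
rewrite -big_distrr /= -cnt_star; apply: leq_trans (leq_mul (leqnn d) le_cnt) _.
by apply: eq_leq; lia.
Qed.

Let typical := busy :\: [set a in X | 32 * g * d ^ 2 <= g' * heavy_pairs a].

Lemma many_typical : #|X| <= 16 * g * #|typical|.
Proof.
have := markov_card X (fun a => g' * heavy_pairs a) (32 * g * d ^ 2).
rewrite -big_distrr /= => H; have {H} := leq_trans H heavy_pairs_sum.
have := many_busy; have := leq_card_setU typical [set a in X | 32 * g * d ^ 2 <= g' * heavy_pairs a].
move: #|[set a in X | _]| => r H1 H2 H3.
have {}H3 : 16 * g * r <= #|X|.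
  have d2 : 0 < 2 * d ^ 2 by rewrite muln_gt0 expn_gt0 (ltnW d_gt1).
  by rewrite -(leq_pmul2l d2); apply: leq_trans H3; apply: eq_leq; lia.
have H4 : #|busy| <= #|typical| + r.
  apply: leq_trans H1; apply: subset_leq_card; rewrite /typical.
  by apply/subsetP => a aX1; rewrite !inE; case: (_ <= g' * _); rewrite ?orbT ?andbF ?aX1 ?orbF //=; move: aX1; rewrite !inE => /andP[->].
have := leq_mul (leqnn (16 * g)) H4; rewrite mulnDr; lia.
Qed.

Let partners a b := [set b' in dead_out a | clash b b'].

Lemma typicalP a : a \in typical -> [/\ a \in X, d <= 4 * g * #|dead_out a| & g' * heavy_pairs a < 32 * g * d ^ 2].
Proof. by rewrite !inE negb_and -ltnNge => /andP[/orP[/negP H|H] /andP[aX H']] //; case: H. Qed.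

(** Clashing pairs are heavy or adjacent. The heavy ones are few because a is
typical, the adjacent ones because out a is a sparse set. *)
Lemma partners_sum a : a \in typical ->
  8 * g * sigma * \sum_(b in dead_out a) #|partners a b| <= d ^ 2.
Proof.
case/typicalP => aX _ Bda.
have s1 : \sum_(b in dead_out a) #|partners a b| <= heavy_pairs a + degsum (out a).
  apply: (@leq_trans (\sum_(b in dead_out a) (#|[set b' in out a | heavy b b']| + #|nbhd b (out a)|))).
    apply: leq_sum => b _; apply: leq_trans (leq_card_setU _ _); apply: subset_leq_card.
    apply/subsetP => b'; rewrite !inE => /andP[/andP[-> _]]; by rewrite /clash.
  rewrite big_split leq_add2l /degsum big_mkcond [leqRHS]big_mkcond; apply: leq_sum => b _.
  by rewrite inE; case: (b \in out a) => /=; case: (isdead b).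
have s2 := @sparse 2 (out a) isT (out_le (XS aX)).
have e1 : 16 * g * sigma * heavy_pairs a <= d ^ 2.
  rewrite -(@leq_pmul2l (32 * g)) ?muln_gt0 ?g_gt0 //.
  apply: leq_trans (ltnW Bda); rewrite mulnA; apply: leq_mul => //.
  by apply: leq_trans g'_large; apply: eq_leq; rewrite /sigma !expnS !expn0; lia.
have e2 : 16 * g * sigma * degsum (out a) <= d ^ 2.
  rewrite -(@leq_pmul2l 8) //; apply: leq_trans s2; rewrite mulnA; apply: leq_mul => //.
  by apply: leq_trans N_large; apply: eq_leq; rewrite /sigma !expnS !expn0; lia.
apply: leq_trans (leq_mul (leqnn _) s1) _.
rewrite -(leq_pmul2l (isT : 0 < 2)) mul2n -addnn [leqRHS]mul2n -[leqRHS]addnn.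
by apply: leq_trans (leq_add e1 e2); apply: eq_leq; lia.
Qed.

Let mild_out a := [set b in dead_out a | #|partners a b| * sigma < d].

Lemma many_mild a : a \in typical -> d <= 8 * g * #|mild_out a|.
Proof.
move=> a_typ; have [aX a_busy _] := typicalP a_typ.
have := markov_card (dead_out a) (fun b => #|partners a b| * sigma) d.
rewrite -big_distrl /= => H1; have H2 := partners_sum a_typ.
have H3 := leq_card_setU (mild_out a) [set b in dead_out a | d <= #|partners a b| * sigma].
move: H1 H3; move: #|[set b in dead_out a | _]| => r H1 H3.
have H4 : #|dead_out a| <= #|mild_out a| + r.
  apply: leq_trans H3; apply: subset_leq_card; apply/subsetP => b bN.
  by rewrite in_setU [b \in mild_out a]inE [X in _ || X]inE bN /=; case: ltnP.
have H5 : 8 * g * r <= d.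
  rewrite -(leq_pmul2l (ltnW d_gt1)) mulnCA; apply: leq_trans (leq_mul (leqnn _) H1) _.
  by rewrite mulnA mulnC mulnA [sigma * _]mulnC.
have := leq_mul (leqnn (8 * g)) H4; rewrite mulnDr; lia.
Qed.

Let good a (t : {ffun 'I_k -> G}) :=
  (t \in ffun_on (mem (mild_out a))) &&
  ~~ [exists p : 'I_k * 'I_k, (p.1 != p.2) && ((t p.1 == t p.2) || clash (t p.1) (t p.2))].

(** Half of the tuples of mild vertices avoid clashes: for every pair of
positions, at most about 2 d / sigma values of the second entry clash with the
first one. *)
Lemma good_many a : a \in typical -> d ^ k <= 2 * (8 * g) ^ k * #|[set t | good a t]|.
Proof.
move=> a_typ; have Nlarge := many_mild a_typ; have d0 := ltnW d_gt1.
have N0 : 0 < #|mild_out a| by move: Nlarge; case: #|_| => //; rewrite muln0; lia.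
pose E (p : 'I_k * 'I_k) (t : {ffun 'I_k -> G}) :=
  (p.1 != p.2) && ((t p.1 == t p.2) || clash (t p.1) (t p.2)).
pose b := (2 * d) %/ sigma.
have sig0 : 0 < sigma by rewrite /sigma muln_gt0 expn_gt0 k_gt0 muln_gt0 g_gt0.
have cell s f : f \in ffun_on (mem (mild_out a)) ->
    #|[set y in mild_out a | E s (overwrite f s.2 y)]| <= b.
  move=> /ffun_onP fN; rewrite /b leq_divRL //.
  case: s => i j; rewrite /E /=; case: (eqVneq i j) => [_|ij] /=.
    by rewrite (eq_card (B := pred0)) ?card0 ?mul0n // => y; rewrite !inE andbF.
  have -> : [set y in mild_out a | (overwrite f j y i == overwrite f j y j) || clash (overwrite f j y i) (overwrite f j y j)]
     = [set y in mild_out a | (f i == y) || clash (f i) y].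
    by apply/setP => y; rewrite !inE !ffunE (negPf ij) eqxx.
  have le1 : #|[set y in mild_out a | (f i == y) || clash (f i) y]| <= 1 + #|partners a (f i)|.
    rewrite -(cards1 (f i)); apply: leq_trans (leq_card_setU _ _).
    apply: subset_leq_card; apply/subsetP => y; rewrite in_setU in_set1 [y \in partners _ _]inE.
    by rewrite inE [y \in mild_out a]inE eq_sym => /andP[/andP[-> _]].
  have := fN i; rewrite inE => /andP[_ lt].
  apply: leq_trans (leq_mul le1 (leqnn _)) _; rewrite mulnDl mul1n mul2n -addnn.
  by apply: leq_add; [exact: d_large | exact: ltnW].
have := union_resample cell; rewrite card_prod !card_ord.
set bad := #|[set f in _ | _]| => Hbad.
have tot : #|[set t | good a t]| + bad = #|mild_out a| ^ k.
  rewrite -[in RHS](card_ord k) -card_ffun_on -(cardID [pred t | [exists s, E s t]] (ffun_on (mem (mild_out a)))) addnC.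
  by congr (_ + _); apply: eq_card => t; rewrite !inE // andbC.
have half : 2 * (k * k * b) <= #|mild_out a|.
  rewrite -(leq_pmul2l sig0).
  have bs : b * sigma <= 2 * d by exact: leq_trunc_div.
  apply: (@leq_trans (2 * (k * k) * (2 * d))).
    by apply: leq_trans (leq_mul (leqnn _) bs); apply: eq_leq; lia.
  apply: leq_trans (leq_mul (leqnn _) (leq_mul (leqnn 2) Nlarge)) _.
  by apply: eq_leq; rewrite /sigma expnS expn1; lia.
have half_bad : 2 * bad <= #|mild_out a| ^ k.
  rewrite -(leq_pmul2r N0) -mulnA; apply: leq_trans (leq_mul (leqnn 2) Hbad) _.
  by rewrite mulnA mulnC leq_mul2l half orbT.
apply: (@leq_trans ((8 * g * #|mild_out a|) ^ k)); first by rewrite leq_exp2r.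
rewrite expnMn [2 * _]mulnC -mulnA leq_mul2l; apply/orP; right; lia.
Qed.

(** There are at most 2 #|X| / w dead vertices, far fewer than typical points,
so a random colour class among them has few vertices V, while many typical points
see exactly a good tuple of V. Two entries of a good tuple do not clash, hence
have fewer than w' d common in-neighbours; a point therefore shares two elements of
V with at most k ^ 2 w' d others. An independent set of this conflict graph is one
side of a linear design with V. *)
Lemma dead_pairs_C4_free_dense e :
  8 ^ (65 + 2 * k) * (2 * (8 * g) ^ k) * k ^ k <= e ->
  32 * g * (e * (65 + k ^ 2 * w')) < w -> C4_free_dense G k.
Proof.
move=> e_large w_large.
have d0 := ltnW d_gt1.
have typical_S0 : typical \subset S0.
  by apply/subsetP => a /typicalP[/XS].
have typical_low : low_degree d S0 64 typical by move=> a /typicalP[aX _ _]; exact: X_low.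
have dead_S0 : dead_set \subset S0 by apply/subsetP => b; rewrite inE => /andP[].
have good_dead_out a t i : a \in typical -> good a t -> t i \in dead_out a.
  by move=> _ /andP[/ffun_onP/(_ i) + _]; rewrite inE => /andP[].
have good_clash a t i j : a \in typical -> good a t -> i != j -> t i != t j /\ ~~ clash (t i) (t j).
  move=> _ /andP[_ /existsPn/(_ (i, j))] /= + ij; rewrite ij /= negb_or => /andP[-> ->] //.
have g_inj a t : a \in typical -> good a t -> injective t.
  move=> aX gat i j eij; apply/eqP; apply: contraTT isT => ij.
  by have [] := good_clash a t i j aX gat ij; rewrite eij eqxx.
have g_nbhd a t : a \in typical -> good a t -> tuple_image t \subset nbhd a dead_set.
  move=> aX gat; apply/subsetP => _ /imsetP[i _ ->].
  have := good_dead_out a t i aX gat; rewrite inE => /andP[bo bd].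
  have aS : a \in S0 by exact: (subsetP typical_S0).
  by move: (subsetP (out_nbhd aS) _ bo); rewrite !inE bd => /andP[-> ->].
have g_indep a t : a \in typical -> good a t -> forall i j, ~~ adj (t i) (t j).
  move=> aX gat i j; case: (eqVneq i j) => [->|ij]; first by rewrite adj_irr.
  by have [_] := good_clash a t i j aX gat ij; rewrite negb_or => /andP[].
have typical_gt0 : 0 < #|typical| by move: X_gt0 many_typical; by case: #|typical| => //; rewrite muln0 leqn0 => /[swap] /eqP ->.
have big : e * ((65 + k ^ 2 * w') * #|dead_set|) < #|typical|.
  move: w_large; clear e_large; move: (65 + k ^ 2 * w') => K wl.
  have w0 : 0 < w by apply: leq_trans wl.
  rewrite -(ltn_pmul2l w0); apply: (@leq_ltn_trans (32 * g * (e * K) * #|typical|)); last first.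
    by rewrite ltn_pmul2r.
  have b1 : w * #|dead_set| <= 32 * g * #|typical|.
    apply: leq_trans few_dead _; have := leq_mul (leqnn 2) many_typical; lia.
  by apply: (@leq_trans (e * K * (w * #|dead_set|))); [|apply: leq_trans (leq_mul (leqnn _) b1) _]; apply: eq_leq; lia.
have [A [V [AX VB dAV indV [Vsmall imA]]]] :=
  random_class d_gt1 out_nbhd out_le out_total typical_S0 typical_low dead_S0 g_inj g_nbhd g_indep good_many k_gt0 e_large big.
(* Conflicts: adjacent points, and points that share two elements of V. *)
pose Rc := [rel a a' : G | (a != a') && (adj a a' || (1 < #|nbhd a V :&: nbhd a' V|))].
have Rcsym : symmetric Rc by move=> a a'; rewrite /= eq_sym adj_sym setIC.
have degA a : a \in A -> #|[set a' in A | Rc a a']| <= (64 + k ^ 2 * w') * d.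
  move=> aA; have [t gat eqN] := imA a aA.
  have a_typ := subsetP AX a aA.
  apply: (@leq_trans #|nbhd a S0 :|: \bigcup_(p in [set p : 'I_k * 'I_k | p.1 != p.2])
      star out (star out X (t p.1)) (t p.2)|).
    apply: subset_leq_card; apply/subsetP => a'; rewrite [a' \in _]inE => /andP[a'A /andP[_ /orP[aa'|]]].
      by rewrite !inE aa' (subsetP typical_S0) ?(subsetP AX).
    case/card_gt1P => b [b' [bI b'I bb']]; move: bI b'I; rewrite eqN => /setIP[/imsetP[i _ ei] bN].
    case/setIP => /imsetP[j _ ej] b'N; rewrite inE; apply/orP; right.
    apply/bigcupP; exists (i, j); first by rewrite inE /=; apply: contraNneq bb' => eij; rewrite ei ej eij.
    have [t' gat' eqN'] := imA a' a'A; have a'_typ := subsetP AX a' a'A.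
    have [a'X _ _] := typicalP a'_typ.
    have inout y : y \in nbhd a' V -> y \in out a'.
      by rewrite eqN' => /imsetP[l _ ->]; have := good_dead_out a' t' l a'_typ gat'; rewrite inE => /andP[].
    by rewrite !inE /= -ei -ej a'X !inout.
  apply: leq_trans (leq_card_setU _ _) _; rewrite mulnDl; apply: leq_add; first exact: typical_low.
  apply: leq_trans (leq_card_bigcup _ _) _.
  apply: (@leq_trans (\sum_(p in [set p : 'I_k * 'I_k | p.1 != p.2]) w' * d)).
    apply: leq_sum => -[i j]; rewrite inE /= => ij.
    by have [_] := good_clash a t i j a_typ gat ij; rewrite negb_or -ltnNge => /andP[/ltnW].
  rewrite sum_nat_const -mulnA leq_mul2r; apply/orP; right.
  by apply: leq_trans (max_card _) _; rewrite card_prod card_ord.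
have [I [sIA indI leA]] := independent_subset Rcsym degA.
have A0 : 0 < #|A| by apply: leq_ltn_trans Vsmall.
have V_lt_I : #|V| < #|I|.
  have Kd : 0 < (65 + k ^ 2 * w') * d by rewrite muln_gt0 d0.
  rewrite -(ltn_pmul2l Kd); apply: leq_trans Vsmall _; apply: leq_trans leA _.
  rewrite leq_mul2r; apply/orP; right.
  have -> : 65 + k ^ 2 * w' = 1 + (64 + k ^ 2 * w') by rewrite addnA.
  by rewrite [leqRHS]mulnDl mul1n -add1n leq_add2r.
have sIV : [disjoint I & V] by apply: disjointWl sIA dAV.
have cardN a : a \in A -> #|nbhd a V| = k.
  move=> aA; have [t gat ->] := imA a aA.
  by rewrite card_imset ?card_ord //; apply: g_inj gat; exact: (subsetP AX).
apply: (@linear_design_C4_free_dense G k I V) => //.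
- rewrite (ltnW V_lt_I) andbT.
  have /card_gt0P[a aI] : 0 < #|I| by apply: leq_ltn_trans V_lt_I.
  apply: leq_trans (subset_leq_card (nbhd_sub a V)).
  by rewrite cardN //; exact: (subsetP sIA).
- move=> a a' aI a'I; case: (eqVneq a a') => [->|aa']; first by rewrite adj_irr.
  by have := indI a a' aI a'I aa'; rewrite /= aa' /= negb_or => /andP[].
- by move=> a aI; rewrite cardN //; exact: (subsetP sIA).
- move=> a a' aI a'I aa'; have := indI a a' aI a'I aa'.
  by rewrite /= aa' /= negb_or -leqNgt => /andP[].
Qed.

End DeadPairs.

(** * Dead or rich *)

(** The conditions under which level j.+1 can use dead_pairs_C4_free_dense: the
thresholds w grow, and the inverse proportions g decrease, fast enough with the
level. *)
Definition scales N d k (g w : nat -> nat) :=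
  forall j, 0 < j < k ->
  [/\ 0 < g j.+1 /\ 0 < w j.+1, 64 * 64 * g j.+1 ^ 2 * k ^ 2 <= N,
      128 * 128 * g j.+1 ^ 3 * k ^ 2 <= g j, 32 * g j.+1 * k ^ 2 <= d &
      exists2 e, 8 ^ (65 + 2 * k) * (2 * (8 * g j.+1) ^ k) * k ^ k <= e &
        32 * g j.+1 * (e * (65 + k ^ 2 * w j.-1)) < w j].

Section Dichotomy.
Variables (G : sgraph) (N d : nat) (S0 : {set G}) (out : G -> {set G}).
Hypothesis d_gt1 : 1 < d.
Hypothesis sparse : forall L (U : {set G}), 0 < L -> #|U| <= L * d ->
  N * degsum U <= 2 * L ^ 2 * d ^ 2.
Hypothesis out_nbhd : forall a, a \in S0 -> out a \subset nbhd a S0.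
Hypothesis out_le : forall a, a \in S0 -> #|out a| <= 2 * d.
Hypothesis out_total : forall a b, a \in S0 -> b \in S0 -> adj a b ->
  b \in out a \/ a \in out b.
Variables (k : nat) (g w : nat -> nat).
Hypothesis k_gt0 : 0 < k.
Hypothesis sc : scales N d k g w.
Implicit Types (a b : G) (X : {set G}).

(** A positive proportion of the ways to pass j times to the star of an
out-neighbour ends with at least w 0 d points. *)
Fixpoint rich j X := if j is i.+1
  then d * #|X| <= 2 * g j * cnt out X (fun b => rich i (star out X b))
  else w 0 * d <= #|X|.

Definition dead_at j X := (0 < j) && dead d out (w j) (w j.-1) (g j) X.

Lemma cnt_leD X (P P1 P2 : pred G) : (forall b, P b -> P1 b || P2 b) ->
  cnt out X P <= cnt out X P1 + cnt out X P2.
Proof.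
move=> PP; rewrite /cnt -big_split; apply: leq_sum => a _.
apply: leq_trans (leq_card_setU _ _); apply: subset_leq_card.
by apply/subsetP => b; rewrite !inE => /andP[-> /PP].
Qed.

(** If X is not dead, a positive proportion of its out-edges leads to vertices
with large stars. If half of them have dead stars, dead_pairs_C4_free_dense
applies; the others have rich stars by induction. *)
Lemma dead_or_rich j X : j <= k -> X \subset S0 -> low_degree d S0 64 X ->
  w j * d <= #|X| -> ~~ dead_at j X -> C4_free_dense G k \/ rich j X.
Proof.
elim: j X => [|j IHj] X jk XS Xlow Xw; first by right.
rewrite /dead_at /dead Xw /= -leqNgt => Xalive.
have [[H|H]|Hrich] : (C4_free_dense G k \/ 0 < j /\
     d * #|X| <= 2 * g j.+1 * cnt out X (fun b => dead_at j (star out X b)))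
   \/ rich j.+1 X; [|by left| |by right].
- case: (leqP (d * #|X|) (2 * g j.+1 * cnt out X (fun b => dead_at j (star out X b)))) => Hdead.
    case: (posnP j) => [j0|j0]; last by left; right.
    move: Hdead; rewrite j0 /dead_at /= /cnt big1 ?muln0 => [|a _]; last first.
      by apply/eqP; rewrite cards_eq0; apply/eqP/setP => b; rewrite !inE andbF.
    by rewrite leqn0 => /eqP H; right => /=; rewrite H.
  have [D|noD] : C4_free_dense G k \/ forall b, b \in G -> w j * d <= #|star out X b| ->
      dead_at j (star out X b) || rich j (star out X b).
    case: (boolP [forall b, (w j * d <= #|star out X b|) ==>
        (dead_at j (star out X b) || rich j (star out X b))]) => [/forallP H|].
      by right => b _; apply/implyP.
    case/forallPn => b; rewrite negb_imply negb_or => /and3P[bw bd br]; left.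
    have sX := star_sub out X b.
    have [] // := IHj _ (ltnW jk) (subset_trans sX XS) _ bw bd.
      by move=> a /(subsetP sX); exact: Xlow.
    by move=> H; rewrite H in br.
  by left; left.
  right => /=.
  have := cnt_leD X (fun b => noD b isT).
  move: Xalive Hdead; rewrite /=; nia.
- have jk' : 0 < j < k by rewrite H.1.
  left; have [[g0 w0] hN hg' hd [e he hw]] := sc jk'.
  have X0 : 0 < #|X| by apply: leq_trans Xw; rewrite muln_gt0 w0 (ltnW d_gt1).
  apply: (@dead_pairs_C4_free_dense G N d S0 out d_gt1 sparse out_nbhd out_le out_total
    k (g j.+1) (g j) (w j) (w j.-1) X) he hw => //.
  by apply: leq_trans H.2 _; rewrite /dead_at H.1.
Qed.

Definition common X j (t : {ffun 'I_j -> G}) := [set x in X | [forall i, t i \in out x]].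
Definition alive X j a := [set t : {ffun 'I_j -> G} |
  (t \in ffun_on (mem (out a))) && (w 0 * d <= #|common X t|)].

Fixpoint richness j := if j is i.+1 then 2 * g j * richness i else 1.

(** The common part of the star at b, for t, is the common part of X for b
followed by t. *)
Lemma alive_cons X j a :
  \sum_(b in out a) #|alive (star out X b) j a| <= #|alive X j.+1 a|.
Proof.
rewrite -[leqRHS]sum1_card (partition_big (fun t : {ffun _ -> G} => t ord0) (mem (out a))) /=; last first.
  by move=> t; rewrite inE => /andP[/ffun_onP].
apply: leq_sum => b ba.
pose cons (t : {ffun 'I_j -> G}) : {ffun 'I_j.+1 -> G} :=
  [ffun i => oapp t b (unlift ord0 i)].
have cons_inj : injective cons.
  move=> t t' /ffunP H; apply/ffunP => i; have := H (lift ord0 i).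
  by rewrite !ffunE liftK.
rewrite -(card_imset _ cons_inj) sum1_card; apply: subset_leq_card.
apply/subsetP => _ /imsetP[t + ->]; rewrite inE => /andP[/ffun_onP ta tX].
apply/andP; split; last by rewrite ffunE unlift_none.
rewrite inE; apply/andP; split.
  by apply/ffun_onP => i; rewrite ffunE; case: unliftP => [i' _|_] //=.
apply: leq_trans tX _; apply: subset_leq_card; apply/subsetP => x.
rewrite !inE => /andP[/andP[xX bx] /forallP tx]; rewrite xX /=.
by apply/forallP => i; rewrite ffunE; case: unliftP => [i' _|_] //=.
Qed.

Lemma rich_alive j X : rich j X ->
  d ^ j * #|X| <= richness j * \sum_(a in X) #|alive X j a|.
Proof.
elim: j X => [|j IHj] X /= HX.
  rewrite !mul1n -sum1_card; apply: leq_sum => a _.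
  apply/card_gt0P; exists [ffun=> a]; rewrite inE; apply/andP; split.
    by apply/ffun_onP => -[].
  apply: leq_trans HX _; apply: subset_leq_card; apply/subsetP => x xX.
  by rewrite inE xX; apply/forallP => -[].
rewrite expnSr -mulnA; apply: leq_trans (leq_mul (leqnn _) HX) _.
rewrite cnt_star mulnCA -[leqRHS]mulnA leq_mul2l; apply/orP; right.
rewrite big_distrr /=.
apply: (@leq_trans (\sum_(b | rich j (star out X b)) richness j *
    \sum_(a in star out X b) #|alive (star out X b) j a|)).
  by apply: leq_sum => b; exact: IHj.
rewrite -big_distrr -star_exchange /= leq_mul2l; apply/orP; right.
apply: leq_sum => a _; apply: leq_trans (alive_cons X j a).
rewrite big_mkcond [leqRHS]big_mkcond; apply: leq_sum => b _.
by rewrite inE; case: (b \in out a) => //=; case: rich.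
Qed.

Lemma dead_or_many_alive X : X \subset S0 -> low_degree d S0 64 X ->
  w k * d <= #|X| -> 0 < #|X| -> ~~ dead_at k X ->
  C4_free_dense G k \/
  exists2 a, a \in X & d ^ k <= richness k * #|alive X k a|.
Proof.
move=> XS Xlow Xw X0 Xalive; have [D|/rich_alive H] := dead_or_rich (leqnn k) XS Xlow Xw Xalive.
  by left.
right; apply/exists_inP; apply: contraLR H => /exists_inPn H; rewrite -ltnNge.
rewrite [d ^ k * _]mulnC big_distrr /= -sum_nat_const.
have /card_gt0P[a0 a0X] := X0.
rewrite (big_setD1 a0) //= [ltnRHS](big_setD1 a0) //= -addSn.
apply: leq_add; first by rewrite ltnNge; exact: H.
apply: leq_sum => a; rewrite inE => /andP[_ aX]; rewrite ltnW // ltnNge; exact: H.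
Qed.
End Dichotomy.

(** * Blowing up a dense family of tuples *)

Section BlowUp.
Variables (V J : finType) (j0 : J) (k : nat) (M : {set V}) (Al : pred {ffun 'I_k -> V}).
Hypothesis M_gt0 : 0 < #|M|.

(** An array f has rows indexed by 'I_k and columns by J; tau picks one entry in
every row. *)
Definition selection (f : {ffun 'I_k * J -> V}) (tau : {ffun 'I_k -> J}) :
  {ffun 'I_k -> V} := [ffun i => f (i, tau i)].

(** Interpolates between the single column j0 (i = 0) and all selections (i = k):
only the first i rows are free. *)
Let partly i (f : {ffun 'I_k * J -> V}) := [forall tau : {ffun 'I_k -> J},
  [forall j : 'I_k, (i <= j) ==> (tau j == j0)] ==> Al (selection f tau)].
Let partly_count i := \sum_(f in ffun_on (mem M)) (partly i f : nat).

Let set_row (i : 'I_k) (f : {ffun 'I_k * J -> V}) (rho : {ffun J -> V}) :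
  {ffun 'I_k * J -> V} := [ffun x => if x.1 == i then rho x.2 else f x].

Lemma partly_set_row (i : 'I_k) f rho :
  partly i.+1 (set_row i f rho) = [forall c, partly i (overwrite f (i, j0) (rho c))].
Proof.
apply/forallP/forallP => H.
  move=> c; apply/forallP => tau; apply/implyP => /forallP ti.
  pose tau' : {ffun 'I_k -> J} := [ffun j => if j == i then c else tau j].
  have -> : selection (overwrite f (i, j0) (rho c)) tau = selection (set_row i f rho) tau'.
    apply/ffunP => j; rewrite !ffunE /= xpair_eqE; case: eqP => [->|_] //=.
    by have := ti i; rewrite leqnn /= => ->.
  apply: (implyP (H tau')); apply/forallP => j; apply/implyP => ij.
  rewrite ffunE; case: (eqVneq j i) => [ji|_]; first by move: ij; rewrite ji ltnn.
  by apply: (implyP (ti j)); exact: ltnW.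
move=> tau; apply/implyP => /forallP ti.
pose tau' : {ffun 'I_k -> J} := [ffun j => if j == i then j0 else tau j].
have -> : selection (set_row i f rho) tau = selection (overwrite f (i, j0) (rho (tau i))) tau'.
  apply/ffunP => j; rewrite !ffunE /= xpair_eqE; case: (eqVneq j i) => [->|_] //=.
  by rewrite eqxx.
apply: (implyP (forallP (H (tau i)) tau')); apply/forallP => j; apply/implyP => ij.
rewrite ffunE; case: (eqVneq j i) => [ji|ji] //; apply: (implyP (ti j)).
by rewrite ltn_neqAle ij andbT eq_sym.
Qed.

Let omega := #|M| ^ (k * #|J|).

Lemma card_omega : #|ffun_on (mem M) : pred {ffun 'I_k * J -> V}| = omega.
Proof. by rewrite card_ffun_on card_prod card_ord. Qed.

(** Fix everything except row i, and let r be the number of values of the entry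
(i, j0) that work. Then r ^ #|J| rows work entirely, and Jensen's inequality
compares the mean of r ^ #|J| with the mean of r. *)
Lemma row_step (i : 'I_k) : partly_count i ^ #|J| <= omega ^ #|J|.-1 * partly_count i.+1.
Proof.
pose r f := \sum_(y in M) (partly i (overwrite f (i, j0) y) : nat).
have sum1 : \sum_(f in ffun_on (mem M)) r f = #|M| * partly_count i.
  apply: (@sum_resample _ _ (ffun_on (mem M)) (mem M)
    (fun f : {ffun _} => f (i, j0)) (fun f y => overwrite f (i, j0) y) (fun f => (partly i f : nat))).
  - by move=> f /ffun_onP.
  - by move=> f y /ffun_onP Hf yM; apply/ffun_onP => x; rewrite ffunE; case: ifP.
  - by move=> f y; rewrite ffunE eqxx.
  - by move=> f y; apply/ffunP => x; rewrite !ffunE; case: eqP => // ->.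
have sum2 : \sum_(f in ffun_on (mem M)) r f ^ #|J| = #|M| ^ #|J| * partly_count i.+1.
  rewrite -card_ffun_on.
  rewrite -(@sum_resample _ _ (ffun_on (mem M)) (ffun_on (mem M))
    (fun f : {ffun _} => [ffun c => f (i, c)]) (fun f rho => set_row i f rho)
    (fun f => (partly i.+1 f : nat))).
  - apply: eq_bigr => f _; rewrite /r -prod_nat_const bigA_distr_big /=.
    apply: eq_bigr => rho _; rewrite partly_set_row.
    case: forallP => [H|H]; first by rewrite big1 // => c _; rewrite H.
    have [c Hc] : exists c, ~~ partly i (overwrite f (i, j0) (rho c)).
      by apply/existsP; rewrite -negb_forall; apply/negP => /forallP.
    by rewrite (bigD1 c) //= (negPf Hc).
  - by move=> f /ffun_onP Hf; apply/ffun_onP => c; rewrite ffunE.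
  - move=> f rho /ffun_onP Hf /ffun_onP Hr; apply/ffun_onP => x; rewrite ffunE.
    by case: ifP.
  - by move=> f rho; apply/ffunP => c; rewrite !ffunE eqxx.
  - by move=> f rho; apply/ffunP => -[x c]; rewrite !ffunE /=; case: eqP => // ->.
have J0 : 0 < #|J| by apply/card_gt0P; exists j0.
have := power_mean (ffun_on (mem M)) r #|J|.-1.
rewrite card_omega prednK // sum1 sum2 expnMn mulnCA leq_pmul2l //.
by rewrite expn_gt0 M_gt0.
Qed.

(** If tuples belong to the family Al with probability at least 1 / E0, then all
selections of a random array do with probability at least E0 ^ -(#|J| ^ k):
freeing a row raises the bound to the power #|J|. *)
Lemma blow_up E0 : #|M| ^ k <= E0 * #|[set t in ffun_on (mem M) | Al t]| ->
  omega <= E0 ^ (#|J| ^ k) *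
    #|[set f in ffun_on (mem M) | [forall tau, Al (selection f tau)]]|.
Proof.
move=> H0.
have base : omega <= E0 * partly_count 0.
  pose set_col (f : {ffun 'I_k * J -> V}) (t : {ffun 'I_k -> V}) :
    {ffun 'I_k * J -> V} := [ffun x => if x.2 == j0 then t x.1 else f x].
  have := @sum_resample _ _ (ffun_on (mem M)) (ffun_on (mem M))
    (fun f : {ffun 'I_k * J -> V} => [ffun i => f (i, j0)]) set_col
    (fun f => (partly 0 f : nat)).
  rewrite -/(partly_count 0) card_ffun_on card_ord => Hs.
  have Mk : 0 < #|M| ^ k by rewrite expn_gt0 M_gt0.
  rewrite -(leq_pmul2l Mk) [leqRHS]mulnCA -Hs; first last.
  - by move=> f t; apply/ffunP => -[x c]; rewrite !ffunE /=; case: eqP => // ->.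
  - by move=> f t; apply/ffunP => c; rewrite !ffunE eqxx.
  - move=> f t /ffun_onP Hf /ffun_onP Hr; apply/ffun_onP => x; rewrite ffunE.
    by case: ifP.
  - by move=> f /ffun_onP Hf; apply/ffun_onP => c; rewrite ffunE.
  rewrite mulnC -card_omega -sum_nat_const big_distrr /=; apply: leq_sum => f _.
  apply: leq_trans H0 _; rewrite leq_mul2l; apply/orP; right.
  rewrite -sum1dep_card big_mkcondr /=; apply: leq_sum => t _.
  case: ifP => // tA; rewrite lt0b; apply/forallP => tau; apply/implyP => /forallP t0.
  suff -> : selection (set_col f t) tau = t by [].
  by apply/ffunP => i; have := t0 i; rewrite !ffunE /= => ->.
have step i : i <= k -> omega <= E0 ^ (#|J| ^ i) * partly_count i.
  elim: i => [|i IHi] ik; first by rewrite expn0 expn1.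
  have {}IHi := IHi (ltnW ik); have row := row_step (Ordinal ik).
  have J0 : 0 < #|J| by apply/card_gt0P; exists j0.
  have O0 : 0 < omega ^ #|J|.-1 by rewrite !expn_gt0 M_gt0.
  rewrite -(leq_pmul2l O0) -expnSr prednK //.
  apply: (@leq_trans ((E0 ^ (#|J| ^ i) * partly_count i) ^ #|J|)); first by rewrite leq_exp2r.
  by rewrite expnMn -expnM -expnSr mulnCA leq_mul2l row orbT.
have := step k (leqnn k); congr (_ <= _ * _).
rewrite /partly_count -sum1dep_card [RHS]big_mkcondr /=; apply: eq_bigr => f _.
have -> : partly k f = [forall tau, Al (selection f tau)].
  apply: eq_forallb => tau; have -> : [forall j : 'I_k, (k <= j) ==> (tau j == j0)]; last by [].
  by apply/forallP => j; rewrite leqNgt ltn_ord.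
by case: forallP.
Qed.
End BlowUp.

(** * A piece of the affine plane *)

Section Lattice.
Variables (G : sgraph) (N d : nat) (S0 : {set G}) (out : G -> {set G}).
Hypothesis d_gt1 : 1 < d.
Hypothesis sparse : forall L (U : {set G}), 0 < L -> #|U| <= L * d ->
  N * degsum U <= 2 * L ^ 2 * d ^ 2.
Hypothesis out_nbhd : forall a, a \in S0 -> out a \subset nbhd a S0.
Hypothesis out_le : forall a, a \in S0 -> #|out a| <= 2 * d.
Implicit Types (a b v : G) (X Y M : {set G}).

(** At most d of the heavy vertices, together with M, would otherwise form a set
of at most 3 d vertices with too many edges. *)
Lemma few_heavy M D lam : 1 < lam -> 18 * D * lam <= N -> #|M| <= 2 * d ->
  lam * #|[set v | d <= D * #|nbhd v M|]| <= d.
Proof.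
move=> lam1 ND Md; set L := [set v | _]; have d0 := ltnW d_gt1.
have sub (L' : {set G}) : L' \subset L -> #|L'| <= d -> lam * #|L'| <= d.
  move=> sL L'd; have UM : #|L' :|: M| <= 3 * d.
    by apply: leq_trans (leq_card_setU _ _) _; lia.
  have ds : d * #|L'| <= D * degsum (L' :|: M).
    apply: (@leq_trans (\sum_(v in L') D * #|nbhd v M|)).
      by rewrite mulnC -sum_nat_const; apply: leq_sum => v /(subsetP sL); rewrite inE.
    rewrite -big_distrr leq_mul2l /=; apply/orP; right.
    rewrite /degsum [leqRHS](big_setID L') /= setUK.
    apply: leq_trans (leq_addr _ _); apply: leq_sum => v _.
    by apply: subset_leq_card; exact: nbhdS (subsetUr _ _).
  have sp := sparse (isT : 0 < 3) UM.
  have d18 : 0 < 18 * d by rewrite muln_gt0.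
  rewrite -(leq_pmul2l d18).
  apply: (@leq_trans (18 * D * lam * degsum (L' :|: M))).
    have := leq_mul (leqnn (18 * lam)) ds; lia.
  apply: leq_trans (leq_mul ND (leqnn _)) _; apply: leq_trans sp _.
  by apply: eq_leq; rewrite !expnS !expn0; lia.
case: (leqP #|L| d) => Ld; first exact: sub.
have [L' sL cL'] := subset_of_card (ltnW Ld).
have := sub L' sL; rewrite cL' => /(_ (leqnn d)); nia.
Qed.

Variables (k p : nat) (w : nat -> nat) (X : {set G}) (a0 : G) (H E W : nat).
Hypothesis k_gt0 : 0 < k.
Hypothesis p_prime : prime p.
Hypothesis le_kp : k <= p.
Hypothesis X_S0 : X \subset S0.
Hypothesis X_low : low_degree d S0 64 X.
Hypothesis a0_S0 : a0 \in S0.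
Hypothesis many_alive : d ^ k <= H * #|alive d out w X k a0|.
Hypothesis w_large : 2 * p ^ 2 * 65 + 2 <= w 0.
Hypothesis E_large : (2 ^ k * H) ^ (p ^ k) <= E.
Hypothesis W_large : (k * p) ^ 2 * p ^ 2 * E * H < W.
Hypothesis d_large : 6 * W <= d.
Hypothesis N_large : 18 * (6 * W * (k * p)) * (3 * W) <= N.

Let cell := ('I_k * 'F_p)%type.
Let line := ('F_p * 'F_p)%type.
Let M := out a0.
Let D := 6 * W * (k * p).
Let L := [set v | d <= D * #|nbhd v M|].
(** A cell (i, x) is a point of the affine plane over 'F_p with abscissa i < k;
the line s meets column i at the cell (i, height s i). *)
Let height (s : line) (i : 'I_k) : 'F_p := (s.1 + i%:R * s.2)%R.
Let on (s : line) (c : cell) := c.2 == height s c.1.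
Let thread (f : {ffun cell -> G}) s := selection f (finfun (height s)).
(** The candidates for the line s. Heavy vertices are left out because they could be
adjacent to entries off the line too often. *)
Let Y f s := common out X (thread f s) :\: L.

(** Three defects of an array f: the entry of c is heavy; the entries of two
distinct cells are equal or adjacent; the entry of a cell c off the line s is
adjacent to more than a fraction 1 / (2 k p) of the candidates for s. *)
Let bad (z : cell * cell * line) (f : {ffun cell -> G}) :=
  let: (c, c', s) := z in
  [|| f c \in L,
      [&& c != c', f c' \notin L & (f c == f c') || adj (f c') (f c)] |
      ~~ on s c && (#|Y f s| < 2 * (k * p) * #|[set a in Y f s | adj a (f c)]|)].

Let W_gt0 : 0 < W. Proof. exact: leq_ltn_trans W_large. Qed.
Let p_gt0 : 0 < p. Proof. exact: prime_gt0. Qed.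
Let M_le : #|M| <= 2 * d. Proof. exact: out_le. Qed.

(** Two distinct lines meet in at most one column, because k <= p makes the
abscissas distinct in 'F_p. *)
Lemma height_inj s s' (i j : 'I_k) : i != j ->
  height s i = height s' i -> height s j = height s' j -> s = s'.
Proof.
case: s s' => [u v] [u' v'] ij; rewrite /height /= => ei ej.
have : ((i%:R - j%:R) * (v - v') = 0 :> 'F_p)%R.
  have -> : ((i%:R - j%:R) * (v - v') =
    (u + i%:R * v - (u' + i%:R * v')) - (u + j%:R * v - (u' + j%:R * v')) :> 'F_p)%R by ring.
  by rewrite ei ej !subrr.
move/eqP; rewrite mulf_eq0 => /orP[|/eqP/subr0_eq ev]; last first.
  by move: ei; rewrite ev => /addIr ->.
rewrite subr_eq0 => /eqP/(congr1 val) /=.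
rewrite !(val_Fp_nat p_prime) !modn_small ?(leq_trans (ltn_ord _)) // => eij.
by case/negP: ij; apply/eqP/val_inj.
Qed.

(** With all the other entries fixed, each defect excludes at most d / (3 W)
values of the entry of c. For the third one this is double counting: every
candidate has fewer than d / D neighbours in M. *)
Lemma bad_cell z f : f \in ffun_on (mem M) ->
  #|[set y in M | bad z (overwrite f z.1.1 y)]| <= d %/ W.
Proof.
case: z => [[c c'] s] /ffun_onP fM; rewrite leq_divRL //=.
have d0 := ltnW d_gt1.
have D0 : 0 < D by rewrite /D !muln_gt0 W_gt0 k_gt0 p_gt0.
set B1 := L; set B2 := if f c' \notin L then f c' |: nbhd (f c') M else set0.
pose B3 := [set y in M | ~~ on s c && (#|Y f s| < 2 * (k * p) * #|[set a in Y f s | adj a y]|)].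
have sub : [set y in M | bad (c, c', s) (overwrite f c y)] \subset B1 :|: B2 :|: B3.
  apply/subsetP => y; rewrite inE => /andP[yM]; rewrite /bad !ffunE eqxx.
  case/or3P => [yL|/and3P[cc' fL fy]|/andP[ns yY]].
  - by rewrite !in_setU yL.
  - rewrite !in_setU /B2; move: fL fy; rewrite [c' == c]eq_sym (negPf cc') => -> /orP[/eqP ->|fy].
      by rewrite !inE eqxx orbT.
    by rewrite !inE yM fy !orbT.
  - rewrite !in_setU [y \in B3]inE yM ns /=; apply/orP; right.
    have eqth : thread (overwrite f c y) s = thread f s.
      apply/ffunP => i; rewrite !ffunE; case: eqP => // eic.
      by move: ns; rewrite -eic /on /= eqxx.
    by move: yY; rewrite /Y eqth.
have b1 : #|B1| * (3 * W) <= d.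
  by rewrite mulnC; apply: few_heavy => //; rewrite -/M; lia.
have b2 : #|B2| * (3 * W) <= d.
  rewrite /B2; case: ifP => [fL|_]; last by rewrite cards0.
  have : #|f c' |: nbhd (f c') M| <= 1 + #|nbhd (f c') M|.
    by apply: leq_trans (leq_card_setU _ _) _; rewrite cards1.
  move: fL; rewrite inE -ltnNge; rewrite /D; move: #|f c' |: _| #|nbhd _ _| => y x.
  have : 0 < k * p by rewrite muln_gt0 k_gt0 p_gt0.
  move: (k * p) => q q0 xD yx.
  have : 6 * W * x <= d by apply: leq_trans (ltnW xD); rewrite leq_mul2r; apply/orP; right; rewrite leq_pmulr.
  have := leq_mul yx (leqnn (6 * W)); lia.
have b3 : #|B3| * (3 * W) <= d.
  have edges_le : D * \sum_(y in M) #|[set a in Y f s | adj a y]| <= d * #|Y f s|.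
    have -> : \sum_(y in M) #|[set a in Y f s | adj a y]| = \sum_(a in Y f s) #|nbhd a M|.
      under eq_bigr => y _ do rewrite -sum1_card.
      under [RHS]eq_bigr => a _ do rewrite -sum1_card.
      rewrite (exchange_big_dep (mem (Y f s))) /=; last by move=> y a _; rewrite inE => /andP[].
      apply: eq_bigr => a aY; apply: eq_bigl => y; by rewrite [a \in _]inE aY [RHS]inE.
    rewrite big_distrr /= [d * _]mulnC -sum_nat_const; apply: leq_sum => a.
    by rewrite !inE -ltnNge => /andP[/ltnW].
  have many_le : #|B3| * #|Y f s| <= 2 * (k * p) * \sum_(y in M) #|[set a in Y f s | adj a y]|.
    rewrite -sum_nat_const big_distrr /= [leqLHS]big_mkcond [leqRHS]big_mkcond /=.
    apply: leq_sum => y _; rewrite inE; case: (y \in M) => //=.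
    by case: ifP => // /andP[_ /ltnW].
  case: (posnP #|Y f s|) => [Y0|Ypos].
    rewrite (_ : B3 = set0) ?cards0 //; apply/setP => y; rewrite !inE Y0; apply/negP.
    case/and3P => _ _; rewrite (_ : [set a in Y f s | adj a y] = set0) ?cards0 ?muln0 //.
    by apply/setP => a; rewrite [Y f s](cards0_eq Y0) !inE.
  rewrite -(leq_pmul2r Ypos).
  apply: leq_trans edges_le; rewrite mulnAC; apply: leq_trans (leq_mul many_le (leqnn _)) _.
  by apply: eq_leq; rewrite /D; lia.
apply: leq_trans (leq_mul (subset_leq_card sub) (leqnn W)) _.
apply: leq_trans (leq_mul (leq_card_setU _ _) (leqnn W)) _.
have := leq_mul (leq_card_setU B1 B2) (leqnn W); lia.
Qed.

Let Al (t : {ffun 'I_k -> G}) := w 0 * d <= #|common out X t|.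

Lemma aliveE : alive d out w X k a0 = [set t in ffun_on (mem M) | Al t].
Proof. by []. Qed.

Let alive_gt0 : 0 < #|alive d out w X k a0| /\ 0 < H.
Proof.
have : 0 < d ^ k by rewrite expn_gt0 (ltnW d_gt1).
by move/leq_trans/(_ many_alive); rewrite muln_gt0 => /andP[].
Qed.

Let M_gt0 : 0 < #|M|.
Proof.
have [/card_gt0P[t]] := alive_gt0; rewrite inE => /andP[/ffun_onP tM _] _.
by apply/card_gt0P; exists (t (Ordinal k_gt0)).
Qed.

(** There are at most #|M| ^ k alive tuples. *)
Lemma M_large : d <= H * #|M|.
Proof.
rewrite leqNgt; apply/negP; rewrite -(ltn_exp2r _ _ k_gt0) ltnNge => /negP; apply.
apply: leq_trans many_alive _; rewrite expnMn; apply: leq_mul.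
  have [_ H0] := alive_gt0; case: k k_gt0 => // m _.
  by rewrite expnS leq_pmulr // expn_gt0 H0.
rewrite -[k in leqRHS]card_ord -card_ffun_on; apply: subset_leq_card.
by apply/subsetP => t; rewrite inE => /andP[].
Qed.

(** By the blow-up lemma all selections are alive with probability at least
1 / E, while a defect occurs with a smaller probability, by the choice of W. *)
Lemma good_selection : exists2 f : {ffun cell -> G}, f \in ffun_on (mem M) &
  (forall tau, Al (selection f tau)) /\ (forall z, ~~ bad z f).
Proof.
pose Good : {set {ffun cell -> G}} := [set f in ffun_on (mem M) | [forall tau, Al (selection f tau)]].
have good_many : #|M| ^ #|{: cell}| <= E * #|Good|.
  have h0 : #|M| ^ k <= (2 ^ k * H) * #|[set t in ffun_on (mem M) | Al t]|.
    rewrite -aliveE -mulnA; apply: leq_trans (leq_mul (leqnn _) many_alive).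
    by rewrite -expnMn leq_exp2r.
  have := blow_up (0%R : 'F_p) M_gt0 h0.
  rewrite card_prod -/Good (card_Fp p_prime) card_ord; move: E_large; move: (_ ^ p ^ k) => E1 H1 H2.
  by apply: leq_trans H2 _; rewrite leq_mul2r H1 orbT.
have := union_resample bad_cell; set Bad := [set f in _ | _] => bad_few.
have [/subset_leq_card GB|/subsetPn[f]] := boolP (Good \subset Bad); last first.
  rewrite inE => /andP[fM /forallP fA] fB; exists f => //; split => // z.
  by apply: contraNN fB => zb; rewrite inE fM; apply/existsP; exists z.
exfalso; move: good_many bad_few; rewrite !card_prod (card_Fp p_prime) card_ord.
have := leq_trunc_div d W; have : 0 < d %/ W by rewrite divn_gt0 //; lia.
move: (d %/ W) => b b0 bW good_many bad_few.
have G0 : 0 < #|Good|.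
  have : 0 < #|M| ^ (k * p) by rewrite expn_gt0 M_gt0.
  by move/leq_trans/(_ good_many); rewrite muln_gt0 => /andP[].
have M_few : #|M| <= (k * p) ^ 2 * p ^ 2 * E * b.
  rewrite -(leq_pmul2r G0) mulnC; apply: leq_trans (leq_mul GB (leqnn _)) _.
  apply: leq_trans bad_few _; apply: leq_trans (leq_mul (leqnn _) good_many) _.
  by apply: eq_leq; rewrite !expnS !expn0 !muln1; lia.
have := M_large; apply/negP; rewrite -ltnNge.
apply: leq_ltn_trans (leq_mul (leqnn H) M_few) _.
have := W_large; rewrite -(ltn_pmul2r b0) mulnC => ltW; apply: leq_trans bW.
by rewrite [b * W]mulnC; apply: leq_ltn_trans ltW; apply: eq_leq; lia.
Qed.

(** V is the set of the k p entries of an array without defects. Each of the p ^ 2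
lines gets a common in-neighbour of its k entries that is adjacent to no other
entry. Since lines meet at most once and k <= p, this is a linear design. *)
Lemma alive_C4_free_dense : C4_free_dense G k.
Proof.
have d0 := ltnW d_gt1.
have [f /ffun_onP fM [fA fgood]] := good_selection.
have fL c : f c \notin L.
  by have := fgood (c, c, (0%R, 0%R)); rewrite /bad !negb_or => /andP[].
have fR c c' : c != c' -> f c != f c' /\ ~~ adj (f c) (f c').
  move=> cc'; have := fgood (c, c', (0%R, 0%R)); rewrite /bad !negb_or cc' fL /= fL /=.
  by rewrite negb_or adj_sym => /andP[/andP[-> ->]].
have f_inj : injective f.
  by move=> c c' ec; apply/eqP; apply: contraTT isT => /fR[]; rewrite ec eqxx.
pose X' s := [set a in Y f s | [forall c, ~~ on s c ==> ~~ adj a (f c)]].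
have YX s a : a \in Y f s -> a \in X /\ forall i, f (i, height s i) \in out a.
  rewrite in_setD => /andP[_]; rewrite inE => /andP[aX /forallP ao]; split => // i.
  by have := ao i; rewrite !ffunE.
have Y_large s : 2 * p ^ 2 * 65 * d < #|Y f s|.
  have := fA (finfun (height s)); rewrite /Al -/(thread f s) => cl.
  have L_small : #|L| <= d.
    apply: (@leq_trans (3 * W * #|L|)); first by rewrite leq_pmull // muln_gt0 W_gt0.
    apply: few_heavy => //; have := W_gt0; clear; lia.
  have : #|common out X (thread f s)| <= #|Y f s| + #|L|.
    apply: leq_trans (leq_card_setU _ _); apply: subset_leq_card; apply/subsetP => x xc.
    by rewrite in_setU in_setD xc andbT orNb.
  have := leq_mul w_large (leqnn d); rewrite mulnDl.
  move: cl L_small d0; clear.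
  move: (w 0 * d) (_ * d) #|Y f s| #|L| #|common _ _ _| => *; lia.
have X'_large s : #|Y f s| <= 2 * #|X' s|.
  pose Z c := [set a in Y f s | ~~ on s c && adj a (f c)].
  have Z_small c : 2 * (k * p) * #|Z c| <= #|Y f s|.
    have := fgood (c, c, s); rewrite /bad !negb_or => /and3P[_ _].
    rewrite negb_and negbK -leqNgt => /orP[ons|].
      rewrite (_ : Z c = set0) ?cards0 ?muln0 //.
      by apply/setP => a; rewrite inE ons andbF [RHS]inE.
    apply: leq_trans; rewrite leq_mul2l; apply/orP; right; apply: subset_leq_card.
    by apply/subsetP => a /setIdP[aY /andP[_ aa]]; rewrite inE aY.
  have Ysub : #|Y f s| <= #|X' s| + \sum_c #|Z c|.
    apply: leq_trans (leq_add (leqnn _) (leq_card_bigcup _ _)).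
    apply: leq_trans (leq_card_setU _ _); apply: subset_leq_card; apply/subsetP => a aY.
    rewrite in_setU inE aY /=; case: forallP => //= nadj; apply/bigcupP.
    have [c] : exists c, ~~ (~~ on s c ==> ~~ adj a (f c)).
      by apply/existsP; rewrite -negb_forall; apply/negP => /forallP.
    by rewrite negb_imply negbK => ac; exists c; rewrite // inE aY.
  have sumZ : 2 * (k * p) * \sum_c #|Z c| <= k * p * #|Y f s|.
    rewrite big_distrr /= -[in leqRHS](card_Fp p_prime) -[k in leqRHS]card_ord -card_prod.
    by rewrite -sum_nat_const; apply: leq_sum => c _; exact: Z_small.
  have q0 : 0 < k * p by rewrite muln_gt0 k_gt0 p_gt0.
  rewrite -(leq_pmul2l q0); have := leq_mul (leqnn (2 * (k * p))) Ysub; rewrite mulnDr.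
  move: sumZ; clear; move: (\sum_c _) #|Y f s| #|X' s| (k * p) => z y x q; nia.
pose R := [rel a b : G | [&& adj a b, a \in S0 & b \in S0]].
have Rsym : symmetric R by move=> a b; rewrite /= adj_sym andbCA andbC -andbA; congr andb; rewrite andbC.
have degR s a : a \in X' s -> #|[set b | R a b]| <= 64 * d.
  rewrite inE => /andP[/YX[aX _] _]; apply: leq_trans (X_low aX).
  by apply: subset_leq_card; apply/subsetP => b; rewrite !inE /= => /and3P[-> _ ->].
have X'_big s : #|{: line}| * (64 * d).+1 < #|X' s|.
  rewrite card_prod (card_Fp p_prime) -(ltn_pmul2l (isT : 0 < 2)).
  apply: leq_trans (X'_large s); apply: leq_trans (Y_large s); rewrite ltnS.
  rewrite -[leqRHS]mulnA; apply: (@leq_trans (2 * p ^ 2 * (64 * d).+1)).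
    by rewrite -mulnn !mulnA.
  by rewrite leq_mul2l; apply/orP; right; move: d0; clear; lia.
have [h [hX' hR]] := greedy_transversal Rsym degR X'_big.
have hY s : h s \in Y f s by have := hX' s; rewrite inE => /andP[].
have hX s : h s \in X by have [] := YX _ _ (hY s).
have hS s : h s \in S0 by apply: (subsetP X_S0).
have h_inj : injective h.
  by move=> s s' es; apply/eqP; apply: contraTT isT => /hR[]; rewrite es eqxx.
have h_adj s c : adj (h s) (f c) = on s c.
  apply/idP/idP => [|]; first last.
    case: c => i x /eqP /= ->; have [_ /(_ i) ho] := YX _ _ (hY s).
    by have := subsetP (out_nbhd (hS s)) _ ho; rewrite inE => /andP[].
  by apply: contraTT => ns; have := hX' s; rewrite inE => /andP[_ /forallP/(_ c)]; rewrite ns.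
pose A := h @: [set: line]; pose V := f @: [set: cell].
have nbhdV s : nbhd (h s) V = [set f (i, height s i) | i : 'I_k].
  apply/setP => b; rewrite inE; apply/andP/imsetP => [[/imsetP[[i x] _ ->]]|[i _ ->]].
    by rewrite h_adj => /eqP /= ->; exists i.
  by rewrite h_adj /on eqxx imset_f.
have cardV : #|V| = k * p by rewrite card_imset // cardsT card_prod card_ord (card_Fp p_prime).
have cardA : #|A| = p * p by rewrite card_imset // cardsT card_prod (card_Fp p_prime).
apply: (@linear_design_C4_free_dense G k A V).
- rewrite -setI_eq0; apply/eqP/setP => b; rewrite !inE; apply/negP => /andP[].
  case/imsetP => s _ -> /imsetP[c _ ehc].
  have : adj (h s) (f (Ordinal k_gt0, height s (Ordinal k_gt0))) by rewrite h_adj /on eqxx.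
  rewrite ehc; case: (eqVneq c (Ordinal k_gt0, height s (Ordinal k_gt0))) => [->|/fR[_ /negP]] //.
  by rewrite adj_irr.
- by rewrite cardV cardA muln_gt0 k_gt0 p_gt0 leq_mul2r le_kp orbT.
- move=> _ _ /imsetP[s _ ->] /imsetP[s' _ ->]; case: (eqVneq s s') => [->|ss'].
    by rewrite adj_irr.
  by have [_] := hR s s' ss'; rewrite /= !hS !andbT.
- move=> _ _ /imsetP[c _ ->] /imsetP[c' _ ->]; case: (eqVneq c c') => [->|/fR[]//].
  by rewrite adj_irr.
- move=> _ /imsetP[s _ ->]; rewrite nbhdV card_imset ?card_ord //.
  by move=> i j /f_inj [].
- move=> _ _ /imsetP[s _ ->] /imsetP[s' _ ->] ss'; rewrite leqNgt.
  apply/negP => /card_gt1P[b [b' [/setIP[]]]]; rewrite !nbhdV.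
  case/imsetP => i _ -> /imsetP[i' _ /f_inj/pair_equal_spec[<- ei]].
  case/setIP => /imsetP[j _ ->] /imsetP[j' _ /f_inj/pair_equal_spec[<- ej]] ij.
  have ij' : i != j by apply: contraNneq ij => ->.
  by case/eqP: ss'; rewrite (height_inj ij' ei ej).
Qed.

End Lattice.

(** * Random induced subgraphs with the four-cycles deleted *)

Section Deletion.
Variables (G : sgraph).
Implicit Types (S B : {set G}).

Lemma degsum_delete S B : B \subset S ->
  degsum S <= degsum (S :\: B) + 2 * \sum_(x in B) #|nbhd x S|.
Proof.
move=> BS; rewrite {1}/degsum (big_setID B) /= (setIidPr BS) mul2n -addnn addnA addnC.
rewrite leq_add2r; apply: (@leq_trans (\sum_(x in S :\: B) (#|nbhd x (S :\: B)| + #|nbhd x B|))).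
  apply: leq_sum => x _; apply: leq_trans (leq_card_setU _ _); apply: subset_leq_card.
  by apply/subsetP => y; rewrite !inE => /andP[-> ->]; case: (y \in B).
rewrite big_split leq_add2l /=.
have e (P : {set G}) x : #|nbhd x P| = \sum_(y in P) (adj x y : nat).
  by rewrite -sum1dep_card big_mkcondr /=; apply: eq_bigr => y _; case: adj.
under eq_bigr => x _ do rewrite e; under [leqRHS]eq_bigr => x _ do rewrite e.
rewrite exchange_big; apply: leq_sum => b _; rewrite [leqRHS](big_setID B) /=.
by apply: leq_trans (leq_addl _ _); apply: leq_sum => x _; rewrite adj_sym.
Qed.

(** Labelled four-cycles: every vertex on a cycle is the first entry of one of its
labellings. *)
Definition four_cycles S : {set G * G * G * G} := [set c |
  let: (x, y, z, v) := c in
  [&& x \in S, y \in S, z \in S, v \in S & [&& adj x y, adj y z, adj z v, adj v x, x != z & y != v]]].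

(** Delete every vertex that lies on a four-cycle. Each deleted vertex is the first
vertex of a labelled cycle and takes at most twice its degree from degsum S. *)
Lemma few_four_cycles_C4_free_dense S k :
  k * #|S| + 2 * \sum_(c in four_cycles S) #|nbhd c.1.1.1 S| < degsum S ->
  C4_free_dense G k.
Proof.
move=> dense; pose B := [set x in S | [exists c in four_cycles S, c.1.1.1 == x]].
have BS : B \subset S by apply/subsetP => x; rewrite inE => /andP[].
have sumB : \sum_(x in B) #|nbhd x S| <= \sum_(c in four_cycles S) #|nbhd c.1.1.1 S|.
  rewrite [leqRHS](partition_big (fun c : G * G * G * G => c.1.1.1) predT) //=.
  rewrite big_mkcond; apply: leq_sum => x _; case: ifP => //.
  rewrite inE => /andP[_ /existsP[c /andP[cS /eqP cx]]].
  by rewrite (bigD1 c) /= ?cS ?cx ?eqxx // leq_addr.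
have := degsum_delete BS => del.
have kS : k * #|S :\: B| < degsum (S :\: B).
  have : k * #|S :\: B| <= k * #|S| by rewrite leq_mul2l subset_leq_card ?subsetDl ?orbT.
  move: del sumB dense; clear; lia.
exists (S :\: B); split; [| |exact: ltnW].
  by apply: contraTneq kS => ->; rewrite cards0 /degsum big_set0 muln0.
move=> x y z v; rewrite !in_setD => /andP[xB xS] /andP[_ yS] /andP[_ zS] /andP[_ vS] xy yz zv vx.
case: (eqVneq x z) => [|xz]; first by left.
case: (eqVneq y v) => [|yv]; first by right.
case/negP: xB; rewrite inE xS; apply/existsP; exists (x, y, z, v).
by rewrite inE xS yS zS vS xy yz zv vx xz yv eqxx.
Qed.
End Deletion.

Section RandomInduced.
Variables (G : sgraph) (q : nat) (R : {set G}).
Hypothesis q_gt0 : 0 < q.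
Let c0 : 'I_q := Ordinal q_gt0.
Let Y (f : {ffun G -> 'I_q}) := [set x in R | f x == c0].
Let mono (Z : {set G}) (f : {ffun G -> 'I_q}) := [forall x in Z, f x == c0].

Lemma mono_card Z : (\sum_f (mono Z f : nat)) * q ^ #|Z| = q ^ #|G|.
Proof.
rewrite -(card_colourings0 c0 Z); congr (_ * _).
by rewrite -sum1dep_card [RHS]big_mkcond; apply: eq_bigr => f _; rewrite /mono; case: forallP.
Qed.

Lemma sum_card_class : q * \sum_f #|Y f| = #|R| * q ^ #|G|.
Proof.
under eq_bigr => f _ do rewrite -sum1dep_card big_mkcondr.
rewrite exchange_big big_distrr -sum_nat_const /=; apply: eq_bigr => x _.
rewrite -(mono_card [set x]) cards1 expn1 mulnC; congr (_ * _); apply: eq_bigr => f _.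
have -> : mono [set x] f = (f x == c0).
  by apply/forall_inP/idP => [|fx y]; [apply; rewrite inE | rewrite inE => /eqP->].
by case: eqP.
Qed.

Lemma sum_degsum_class : q ^ 2 * \sum_f degsum (Y f) = degsum R * q ^ #|G|.
Proof.
have e f : degsum (Y f) = \sum_(x in R) \sum_(y in nbhd x R) (mono [set x; y] f : nat).
  rewrite /degsum [LHS]big_mkcond [RHS]big_mkcond; apply: eq_bigr => x _; rewrite inE.
  case: (x \in R) => //=; case: (eqVneq (f x) c0) => fx; last first.
    rewrite big1 // => y _; apply/eqP; rewrite eqb0; apply: contraNN fx.
    by move/forall_inP; apply; rewrite !inE eqxx.
  rewrite -sum1_card [LHS]big_mkcond [RHS]big_mkcond; apply: eq_bigr => y _; rewrite !inE.
  case: (y \in R) => //=; case: (adj x y); rewrite ?andbF ?andbT //.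
  have -> : mono [set x; y] f = (f y == c0).
    apply/forall_inP/idP => [|fy z]; first by apply; rewrite !inE eqxx orbT.
    by rewrite !inE => /orP[] /eqP -> //; apply/eqP.
  by case: eqP.
under eq_bigr => f _ do rewrite e.
rewrite exchange_big big_distrr /degsum big_distrl; apply: eq_bigr => x _ /=.
rewrite exchange_big big_distrr -sum_nat_const; apply: eq_bigr => y /=.
rewrite inE => /andP[_ xy]; rewrite -(mono_card [set x; y]) mulnC cards2.
by case: eqVneq xy => [->|//]; rewrite adj_irr.
Qed.

(** Five given vertices lie in the class with probability q ^ -5. A neighbour u of
the first vertex may be one of the three other vertices of the cycle, and then
only four vertices have to be in the class: this gives the term 3 q. *)
Lemma sum_cycles_class D : (forall x, x \in R -> #|nbhd x R| <= D) ->
  q ^ 5 * \sum_f \sum_(c in four_cycles (Y f)) #|nbhd c.1.1.1 (Y f)|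
    <= #|four_cycles R| * (D + 3 * q) * q ^ #|G|.
Proof.
move=> degR; pose pts (c : G * G * G * G) := [set c.1.1.1; c.1.1.2; c.1.2; c.2].
have e f : \sum_(c in four_cycles (Y f)) #|nbhd c.1.1.1 (Y f)| <=
    \sum_(c in four_cycles R) \sum_(u in nbhd c.1.1.1 R) (mono (u |: pts c) f : nat).
  rewrite [leqLHS]big_mkcond [leqRHS]big_mkcond; apply: leq_sum => -[[[x y] z] v] _ /=.
  case: ifP => // cY.
  have cY' := cY; move: cY'; rewrite inE => /and5P[xY yY zY vY cyc].
  have cR : (x, y, z, v) \in four_cycles R.
    by rewrite inE cyc; move: xY yY zY vY; rewrite !inE => /andP[-> _] /andP[-> _] /andP[-> _] /andP[-> _].
  rewrite cR -sum1_card [leqLHS]big_mkcond [leqRHS]big_mkcond; apply: leq_sum => u _.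
  rewrite !inE; case: (u \in R) => //=; case: (eqVneq (f u) c0) => //= fu; case: (adj x u) => //.
  rewrite lt0b; apply/forall_inP => t; rewrite !inE /= => /orP[/eqP->|]; first by apply/eqP.
  by move: xY yY zY vY; rewrite !inE => /andP[_ fx] /andP[_ fy] /andP[_ fz] /andP[_ fv]
     /orP[/orP[/orP[]|]|] /eqP->.
apply: (@leq_trans (q ^ 5 * \sum_f \sum_(c in four_cycles R) \sum_(u in nbhd c.1.1.1 R) (mono (u |: pts c) f : nat))).
  by rewrite leq_mul2l; apply/orP; right; apply: leq_sum => f _; exact: e.
rewrite exchange_big big_distrr /= -mulnA -sum_nat_const; apply: leq_sum => -[[[x y] z] v] /=.
rewrite inE => /and5P[xR yR zR vR /and5P[xy yz zv vx /andP[xz yv]]].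
rewrite exchange_big big_distrr /=; set Z := pts (x, y, z, v).
have neq (a b : G) : adj a b -> a != b by apply: contraTneq => ->; rewrite adj_irr.
have cZ : #|Z| = 4.
  rewrite /Z /pts /= -!setUA !cardsU1 cards1 !inE !negb_or.
  by rewrite (neq _ _ xy) xz (neq _ _ yz) yv (neq _ _ zv) eq_sym (neq _ _ vx).
have term u : q ^ 5 * \sum_f (mono (u |: Z) f : nat) = q ^ (u \in Z) * q ^ #|G|.
  rewrite -(mono_card (u |: Z)) cardsU1 cZ mulnCA mulnC; congr (_ * _).
  by rewrite -expnD; case: (u \in Z).
under eq_bigr => u _ do rewrite term.
rewrite -big_distrl leq_mul2r /=; apply/orP; right.
apply: (@leq_trans (\sum_(u in nbhd x R) (1 + q * (u \in Z :\ x)))).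
  apply: leq_sum => u; rewrite inE => /andP[_ /neq xu].
  by rewrite in_setD1 eq_sym xu /=; case: (u \in Z); rewrite ?expn1 ?muln1 ?leq_addl.
rewrite big_split sum1_card /=; apply: leq_add; first exact: degR.
rewrite -big_distrr /= [3 * q]mulnC leq_mul2l; apply/orP; right.
have <- : #|Z :\ x| = 3.
  by have := cardsD1 x Z; rewrite cZ /Z /pts !inE eqxx => -[].
rewrite -sum1_card [leqLHS]big_mkcond [leqRHS]big_mkcond; apply: leq_sum => u _.
by case: (u \in nbhd _ _); case: (u \in _ :\ _).
Qed.

(** Compare the expected values of both sides of few_four_cycles_C4_free_dense for
the part Y of R that receives a given colour among q. *)
Lemma random_induced_C4_free_dense k D : (forall x, x \in R -> #|nbhd x R| <= D) ->
  k * #|R| * q ^ 4 + 2 * #|four_cycles R| * (D + 3 * q) < degsum R * q ^ 3 ->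
  C4_free_dense G k.
Proof.
move=> degR big.
have [f Hf] : exists f, k * #|Y f| + 2 * \sum_(c in four_cycles (Y f)) #|nbhd c.1.1.1 (Y f)|
    < degsum (Y f); last exact: few_four_cycles_C4_free_dense Hf.
apply/existsP; apply: contraLR big => /existsPn H; rewrite -leqNgt.
have qG : 0 < q ^ #|G| by rewrite expn_gt0 q_gt0.
rewrite -(leq_pmul2r qG) mulnAC -sum_degsum_class.
have sumH : \sum_f degsum (Y f) <= k * \sum_f #|Y f| +
   2 * \sum_f \sum_(c in four_cycles (Y f)) #|nbhd c.1.1.1 (Y f)|.
  by rewrite !big_distrr -big_split; apply: leq_sum => f _; move: (H f); rewrite -leqNgt.
have := sum_cycles_class degR; have := sum_card_class; move: sumH; clear.
rewrite mulnDl; move: (\sum_f degsum _) (\sum_f #|Y f|) (\sum_f \sum_(c in _) _) => s y c sumH eY le_c.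
apply: (@leq_trans (q ^ 5 * (k * y + 2 * c))).
  by rewrite mulnAC -expnD leq_mul2l sumH orbT.
rewrite mulnDr; apply: leq_add.
  have -> : k * #|R| * q ^ 4 * q ^ #|G| = k * q ^ 4 * (#|R| * q ^ #|G|) by lia.
  rewrite -eY; apply: eq_leq; rewrite (expnS q 4); lia.
by have := leq_mul (leqnn 2) le_c; move: (_ ^ #|_|) (q ^ 5) => *; lia.
Qed.
End RandomInduced.

(** * Graphs of maximum degree of order d *)

Section Light.
Variables (G : sgraph) (N d : nat).
Hypothesis sparse : forall L (U : {set G}), 0 < L -> #|U| <= L * d ->
  N * degsum U <= 2 * L ^ 2 * d ^ 2.
Implicit Types (R U : {set G}).

(** The edge opposite to xy in a four-cycle joins two vertices of the union of the
neighbourhoods of x and y, a set of at most 2 C d vertices, hence sparse. *)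
Lemma four_cycles_le C R : 0 < C -> (forall x, x \in R -> #|nbhd x R| <= C * d) ->
  N * #|four_cycles R| <= 8 * C ^ 3 * d ^ 3 * #|R|.
Proof.
move=> C0 degR; pose U x y := nbhd x R :|: nbhd y R.
have le_sum : #|four_cycles R| <= \sum_(x in R) \sum_(y in nbhd x R) degsum (U x y).
  have mk (F : G * G * G * G -> nat) : \sum_c F c = \sum_x \sum_y \sum_z \sum_v F (x, y, z, v).
    transitivity (\sum_p \sum_v F (p, v)); first by rewrite [RHS]pair_bigA; apply: eq_bigr => -[].
    transitivity (\sum_p \sum_z \sum_v F (p, z, v)); first by rewrite [RHS]pair_bigA; apply: eq_bigr => -[].
    by rewrite [RHS]pair_bigA; apply: eq_bigr => -[].
  rewrite -sum1_card big_mkcond mk [leqRHS]big_mkcond /=; apply: leq_sum => x _.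
  case: (boolP (x \in R)) => xR; last first.
    rewrite big1 // => y _; rewrite big1 // => z _; rewrite big1 // => v _.
    by rewrite inE (negPf xR).
  rewrite [leqRHS]big_mkcond; apply: leq_sum => y _; rewrite [y \in nbhd _ _]inE.
  case: (boolP ((y \in R) && adj x y)) => [/andP[yR xy]|nxy]; last first.
    rewrite big1 // => z _; rewrite big1 // => v _; case: ifP => //.
    rewrite inE => /and5P[_ yR _ _ /and5P[xy _ _ _ _]].
    by rewrite yR xy in nxy.
  rewrite /degsum [leqRHS]big_mkcond; apply: leq_sum => z _.
  rewrite -sum1_card; case: (boolP (z \in U x y)) => zU; last first.
    rewrite big1 // => v _; case: ifP => //.
    rewrite inE => /and5P[_ _ zR _ /and5P[_ yz _ _ _]].
    by case/negP: zU; rewrite !inE zR yz orbT.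
  rewrite [leqRHS]big_mkcond; apply: leq_sum => v _; case: ifP => //.
  rewrite inE => /and5P[_ _ zR vR /and5P[_ yz zv vx _]].
  by rewrite !inE vR (adj_sym x) vx zv.
apply: leq_trans (leq_mul (leqnn N) le_sum) _.
rewrite big_distrr mulnC -sum_nat_const /=; apply: leq_sum => x xR.
apply: (@leq_trans (\sum_(y in nbhd x R) 8 * C ^ 2 * d ^ 2)).
  rewrite big_distrr /=; apply: leq_sum => y; rewrite inE => /andP[yR _].
  have UL : #|U x y| <= 2 * C * d.
    apply: leq_trans (leq_card_setU _ _) _.
    have := leq_add (degR x xR) (degR y yR); lia.
  apply: leq_trans (sparse _ UL) _; first by rewrite muln_gt0.
  by apply: eq_leq; rewrite expnMn; lia.
rewrite sum_nat_const; apply: leq_trans (leq_mul (degR x xR) (leqnn _)) _.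
by apply: eq_leq; rewrite !expnS !expn0; lia.
Qed.

(** With q = d / (256 k) colours a class has expected average degree above k.
The four-cycles are too few to matter, because N is large compared with k and C. *)
Lemma light_C4_free_dense k C n R : 0 < C -> 0 < k -> 256 * k <= d -> 0 < n ->
  (forall x, x \in R -> #|nbhd x R| <= C * d) -> #|R| <= n ->
  d * n <= 128 * degsum R ->
  128 * 256 * (256 * k) ^ 3 * C ^ 3 * (C + 3) < N -> C4_free_dense G k.
Proof.
move=> C0 k0 dK n0 degR Rn dense NC.
have K0 : 0 < 256 * k by rewrite muln_gt0.
have := leq_trunc_div d (256 * k); have := ltn_ceil d K0.
have : 0 < d %/ (256 * k) by rewrite divn_gt0.
move: (d %/ _) => q q0 qd dq.
apply: (random_induced_C4_free_dense q0 degR).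
have fc := four_cycles_le C0 degR.
have q3 : 0 < q ^ 3 by rewrite expn_gt0 q0.
have d3 : d ^ 3 <= 8 * (256 * k) ^ 3 * q ^ 3.
  have -> : 8 * (256 * k) ^ 3 * q ^ 3 = (2 * (256 * k) * q) ^ 3 by rewrite !expnMn.
  by rewrite leq_exp2r //; apply: leq_trans (ltnW qd) _; nia.
have part1 : 256 * (k * #|R| * q ^ 4) <= d * n * q ^ 3.
  rewrite (expnS q 3); apply: (@leq_trans (#|R| * (q * (256 * k)) * q ^ 3)); first by apply: eq_leq; lia.
  by rewrite leq_mul2r [d * n]mulnC leq_mul // orbT.
have d0 : 0 < d by lia.
have part2 : 256 * (2 * #|four_cycles R| * (C * d + 3 * q)) < d * n * q ^ 3.
  have N0 : 0 < N by exact: leq_ltn_trans NC.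
  rewrite -(ltn_pmul2l N0).
  have qled : q <= d by apply: leq_trans dq; rewrite leq_pmulr.
  have s1 : C * d + 3 * q <= (C + 3) * d by nia.
  apply: (@leq_ltn_trans (512 * (8 * C ^ 3 * d ^ 3 * n) * ((C + 3) * d))).
    have f2 : N * #|four_cycles R| <= 8 * C ^ 3 * d ^ 3 * n.
      by apply: leq_trans fc _; rewrite leq_mul2l Rn orbT.
    have := leq_mul (leq_mul (leqnn 512) f2) s1; apply: leq_trans.
    by apply: eq_leq; clear; lia.
  have -> : 512 * (8 * C ^ 3 * d ^ 3 * n) * ((C + 3) * d) =
     (d * n) * (d ^ 3 * (16 * 256 * C ^ 3 * (C + 3))) by clear; lia.
  have -> : N * (d * n * q ^ 3) = (d * n) * (N * q ^ 3) by clear; lia.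
  rewrite ltn_pmul2l ?muln_gt0 ?d0 //.
  apply: leq_ltn_trans (leq_mul d3 (leqnn _)) _.
  have := NC; rewrite -(ltn_pmul2r q3); apply: leq_ltn_trans.
  by apply: eq_leq; clear; move: (_ ^ 3) (_ ^ 3) (_ ^ 3) => *; lia.
have := leq_mul dense (leqnn (q ^ 3)); move: part1 part2; clear.
move: (k * _ * _) (2 * _ * _) (d * n * _) => *; lia.
Qed.
End Light.

(** A0 has at least d #|A0| / 4 out-edges. Few lead to vertices with large stars,
because A0 is dead. Few lead to the other vertices of degree above C d: there are at
most 4 #|S0| / C of them, each the head of fewer than w' d out-edges. The
remaining out-edges join vertices of degree at most C d. *)
Lemma dead_singles_dense (G : sgraph) (d C w' : nat) (S0 A0 : {set G}) (out : G -> {set G}) :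
  0 < d -> (forall a, a \in S0 -> out a \subset nbhd a S0) ->
  degsum S0 <= 4 * d * #|S0| -> A0 \subset S0 -> #|S0| <= 16 * #|A0| ->
  (forall a, a \in A0 -> d <= 4 * #|out a|) -> low_degree d S0 64 A0 ->
  16 * cnt out A0 (fun b => w' * d <= #|star out A0 b|) < d * #|A0| ->
  1024 * w' <= C -> 64 <= C ->
  d * #|S0| <= 128 * degsum [set v in S0 | #|nbhd v S0| <= C * d].
Proof.
move=> d0 out_nbhd dsS A0S A0n outA lowA dead Cw C64; set R := [set v in S0 | _].
pose big := [set v in S0 | C * d <= #|nbhd v S0|].
have big_few : C * #|big| <= 4 * #|S0|.
  rewrite -(leq_pmul2l d0).
  have := leq_trans (markov_card S0 (fun v => #|nbhd v S0|) (C * d)) dsS.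
  by rewrite -/big; clear; move: #|big| #|S0| => *; lia.
pose light b := #|star out A0 b| < w' * d.
have split3 : \sum_(a in A0) #|out a| <= cnt out A0 (fun b => w' * d <= #|star out A0 b|)
    + (cnt out A0 (fun b => light b && (b \in big)) + cnt out A0 (fun b => b \in R)).
  rewrite /cnt -!big_split; apply: leq_sum => a aA.
  have aS := subsetP A0S a aA.
  apply: leq_trans (leq_add (leqnn _) (leq_card_setU _ _)).
  apply: leq_trans (leq_card_setU _ _); apply: subset_leq_card; apply/subsetP => b bo.
  have := subsetP (out_nbhd a aS) b bo; rewrite inE => /andP[bS _].
  rewrite !inE bo bS /= /light; case: (ltnP #|star out A0 b| _) => //= _.
  exact: leq_total.
have cnt_big : cnt out A0 (fun b => light b && (b \in big)) <= #|big| * (w' * d).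
  rewrite cnt_star -sum_nat_const big_mkcond [leqRHS]big_mkcond; apply: leq_sum => b _.
  by case: (boolP (light b)) => //= lb; case: (b \in big) => //; exact: ltnW.
have cnt_R : cnt out A0 (fun b => b \in R) <= degsum R.
  rewrite /cnt /degsum big_mkcond [leqRHS]big_mkcond; apply: leq_sum => a _.
  case: ifP => // aA; have aS := subsetP A0S a aA.
  have -> : a \in R.
    by rewrite inE aS (leq_trans (lowA a aA)) // leq_mul2r C64 orbT.
  apply: subset_leq_card; apply/subsetP => b; rewrite inE => /andP[bo bR].
  have := subsetP (out_nbhd a aS) b bo; rewrite !inE => /andP[-> ->].
  by move: bR; rewrite inE => /andP[_ ->].
have sum_out : d * #|A0| <= 4 * \sum_(a in A0) #|out a|.
  by rewrite mulnC -sum_nat_const big_distrr; apply: leq_sum.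
have big_w : 16 * (#|big| * (w' * d)) <= d * #|A0|.
  have := leq_mul Cw (leqnn #|big|); have := big_few; have := A0n; clear -d0.
  move: #|S0| #|A0| #|big| => n m b h1 h2 h3.
  have : 16 * (b * w') <= m by lia.
  by move/(leq_mul (leqnn d)); apply: leq_trans; apply: eq_leq; lia.
have := leq_mul (leqnn d) A0n; move: split3 cnt_big cnt_R sum_out big_w dead; clear.
move: (cnt _ _ _) (cnt _ _ _) (cnt _ _ _) (\sum_(_ in _) _) (degsum R) (#|big| * _) => *; lia.
Qed.

(** * The extremal subgraph and the hierarchy of constants *)

(** The constants are chosen in the order g, p, E, w, W, C, and N and d have to be
large in terms of all of them. The last condition makes A0 larger than w k d, by
local sparsity. *)
Record hierarchy k N d (g w : nat -> nat) p E W C : Prop := Hierarchy {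
  hier_prime : prime p;
  hier_kp : k <= p;
  hier_gk : g k = 16;
  hier_wk : 0 < w k;
  hier_w0 : 2 * p ^ 2 * 65 + 2 <= w 0;
  hier_E : (2 ^ k * richness g k) ^ (p ^ k) <= E;
  hier_W : (k * p) ^ 2 * p ^ 2 * E * richness g k < W;
  hier_Cw : 1024 * w k.-1 <= C;
  hier_C : 64 <= C;
  hier_scales : scales N d k g w;
  hier_dW : 6 * W <= d;
  hier_dk : 256 * k <= d;
  hier_NW : 18 * (6 * W * (k * p)) * (3 * W) <= N;
  hier_NC : 128 * 256 * (256 * k) ^ 3 * C ^ 3 * (C + 3) < N;
  hier_Nw : 2 * (16 * w k) ^ 2 < N }.

Lemma hierarchy_exists k : 0 < k -> exists g w p E W C N0 d0,
  forall N d, N0 <= N -> d0 <= d -> hierarchy k N d g w p E W C.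
Proof.
move=> k0; have [p kp p_prime] := prime_above k.
(* Indexed from the top, because g j is determined by g j.+1 and g k = 16. *)
pose gg := fix gg i := if i is i'.+1 then 128 * 128 * gg i' ^ 3 * k ^ 2 else 16.
pose g j := gg (k - j).
have gk : g k = 16 by rewrite /g subnn.
have g_pos j : 0 < g j.
  rewrite /g; elim: (k - j) => // i IHi.
  have -> : gg i.+1 = 128 * 128 * gg i ^ 3 * k ^ 2 by [].
  by rewrite muln_gt0 expn_gt0 k0 muln_gt0 expn_gt0 IHi.
have g_step j : j < k -> g j = 128 * 128 * g j.+1 ^ 3 * k ^ 2.
  by move=> jk; rewrite /g -(subnSK jk).
have ee_ex : exists ee : nat -> nat, forall j,
  8 ^ (65 + 2 * k) * (2 * (8 * g j.+1) ^ k) * k ^ k <= ee j.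
  exists (fun j => 8 ^ (65 + 2 * k) * (2 * (8 * g j.+1) ^ k) * k ^ k) => j.
  exact: leqnn.
case: ee_ex => ee eeP.
have [E hE] : exists E, (2 ^ k * richness g k) ^ (p ^ k) <= E.
  by eexists; exact: leqnn.
clearbody g; clear gg.
pose w := fix w j := if j is i.+1 then
  (32 * g j.+1 * (ee j * (65 + k ^ 2 * w i))).+1 else 2 * p ^ 2 * 65 + 2.
have w_pos j : 0 < w j by case: j => //=; rewrite addn2.
have w0 : w 0 = 2 * p ^ 2 * 65 + 2 by [].
have w_step j : 0 < j -> 32 * g j.+1 * (ee j * (65 + k ^ 2 * w j.-1)) < w j by case: j.
clearbody w.
have [W hW] : exists W, (k * p) ^ 2 * p ^ 2 * E * richness g k < W.
  by eexists; exact: leqnn.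
have [C [hCw hC]] : exists C, 1024 * w k.-1 <= C /\ 64 <= C.
  by exists (1024 * w k.-1 + 64); rewrite leq_addr leq_addl.
have [N1 hN1] : exists N1, forall j : 'I_k, 64 * 64 * g j.+1 ^ 2 * k ^ 2 <= N1.
  exists (\max_(j < k) 64 * 64 * g j.+1 ^ 2 * k ^ 2) => j.
  exact: (bigmax_sup j).
have [d1 hd1] : exists d1, forall j : 'I_k, 32 * g j.+1 * k ^ 2 <= d1.
  exists (\max_(j < k) 32 * g j.+1 * k ^ 2) => j.
  exact: (bigmax_sup j).
have sum4 N' (a b c e : nat) : a + b + c + e <= N' -> [/\ a <= N', b <= N', c <= N' & e <= N'].
  by move=> ?; split; lia.
exists g, w, p, E, W, C.
exists (N1 + 18 * (6 * W * (k * p)) * (3 * W) +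
  (128 * 256 * (256 * k) ^ 3 * C ^ 3 * (C + 3)).+1 + (2 * (16 * w k) ^ 2).+1).
exists (d1 + 6 * W + 256 * k + 0) => N d /sum4[hN hNW hNC hNw] /sum4[hd hdW hdk _].
constructor => //; first exact: ltnW; first by rewrite w0.
move=> j /andP[j0 jk]; split => //.
- exact: leq_trans (hN1 (Ordinal jk)) hN.
- by rewrite -g_step.
- exact: leq_trans (hd1 (Ordinal jk)) hd.
- by exists (ee j); [exact: eeP | exact: w_step].
Qed.

Section Extremal.
Variable G : sgraph.
Implicit Types S U : {set G}.

Lemma degsum_le S : degsum S <= #|S| * #|S|.-1.
Proof.
rewrite -sum_nat_const; apply: leq_sum => x xS; have := cardsD1 x S; rewrite xS => ->.
apply: subset_leq_card; apply/subsetP => y; rewrite !inE => /andP[-> xy]; rewrite andbT.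
by apply: contraTneq xy => ->; rewrite adj_irr.
Qed.

Lemma min_degree_le U : U != set0 ->
  exists2 x, x \in U & #|U| * #|nbhd x U| <= degsum U.
Proof.
case/set0Pn => x0 x0U; case: (arg_minnP (fun x => #|nbhd x U|) x0U) => x xU minx.
by exists x => //; rewrite -sum_nat_const; apply: leq_sum => y; exact: minx.
Qed.

(** Take S minimal with average degree at least d. A proper subset has smaller
average degree, hence a vertex of degree below d. For S itself, deleting a vertex of
minimum degree leaves average degree below d, so that this degree is at most 2 d. *)
Lemma minimal_dense_subset d : 1 < d -> 0 < #|G| -> d * #|G| <= degsum [set: G] ->
  exists S, [/\ d < #|S|, d * #|S| <= degsum S, degsum S <= 4 * d * #|S| &
    forall U, U \subset S -> U != set0 -> exists2 x, x \in U & #|nbhd x U| <= 2 * d].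
Proof.
move=> d1 G0 dense; have d0 := ltnW d1; pose P S := (S != set0) && (d * #|S| <= degsum S).
have PT : P [set: G] by rewrite /P -card_gt0 cardsT G0.
have [S /minsetP[/andP[S0 dS] minS] _] := minset_exists PT.
have Spos : 0 < #|S| by rewrite card_gt0.
have dltS : d < #|S|.
  have := leq_trans dS (degsum_le S); rewrite [leqRHS]mulnC leq_pmul2r //; lia.
have proper U : U \subset S -> U != S -> U != set0 -> degsum U < d * #|U|.
  move=> US nUS U0; rewrite ltnNge; apply: contra nUS => dU.
  by apply/eqP/minS => //; rewrite /P U0.
have [x xS minx] := min_degree_le S0.
have cS : #|S :\ x| = #|S|.-1 by have := cardsD1 x S; rewrite xS; lia.
have dSx : degsum (S :\ x) < d * #|S|.-1.
  rewrite -cS; apply: proper; first exact: subsetDl.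
    by apply/eqP => e; have := setD11 x S; rewrite e xS.
  by rewrite -card_gt0 cS; lia.
have degx : #|nbhd x S| <= 2 * d.
  move: minx dSx dltS; rewrite (degsumD1 xS); clear -d1.
  move: #|S| #|nbhd x S| (degsum _) => n f s h1 h2 h3.
  rewrite leqNgt; apply/negP => h4.
  case: n h1 h2 h3 => [|[|[|m]]] h1 h2 h3; [lia|lia|lia|].
  have h5 : m.+1 * f <= s by lia.
  have h6 : m.+1 * (2 * d).+1 <= m.+1 * f by rewrite leq_mul2l h4 orbT.
  have h7 : d * m.+2 <= m.+1 * (2 * d) by nia.
  by move: h2 => /=; lia.
exists S; split => //.
  move: dSx degx dltS; rewrite (degsumD1 xS); clear; move: #|S| #|nbhd _ _| (degsum _) => n f s.
  by case: n => // n /=; rewrite !mulnS; lia.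
move=> U US U0; have [->|nUS] := eqVneq U S; first by exists x.
have [y yU miny] := min_degree_le U0; exists y => //.
have := leq_ltn_trans miny (proper U US nUS U0).
by rewrite [d * _]mulnC ltn_pmul2l ?card_gt0 //; lia.
Qed.
End Extremal.

Section Core.
Variables (G : sgraph) (k N d : nat) (g w : nat -> nat) (p E W C : nat).
Hypothesis k_gt0 : 0 < k.
Hypothesis hier : hierarchy k N d g w p E W C.
Hypothesis d_gt1 : 1 < d.
Hypothesis sparse : forall L (U : {set G}), 0 < L -> #|U| <= L * d ->
  N * degsum U <= 2 * L ^ 2 * d ^ 2.

(** If A0, the set of vertices with large out-degree and degree at most 64 d, is
dead, the vertices of degree at most C d span a dense graph; otherwise A0 is rich. *)
Lemma dense_C4_free_dense : 0 < #|G| -> d * #|G| <= degsum [set: G] -> C4_free_dense G k.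
Proof.
move=> G0 dense; have d0 := ltnW d_gt1.
have [S0 [dS0 dsS0 dsS0' degen]] := minimal_dense_subset d_gt1 G0 dense.
have [out [out_nbhd out_le out_total]] := bounded_orientation degen.
have S0pos : 0 < #|S0| by exact: leq_ltn_trans dS0.
have out_sum : degsum S0 <= 2 * \sum_(a in S0) #|out a|.
  have -> : 2 * \sum_(a in S0) #|out a| =
      \sum_(a in S0) \sum_(b in S0) ((b \in out a) + (a \in out b)).
    under [RHS]eq_bigr => a _ do rewrite big_split.
    rewrite big_split /= [X in _ = _ + X]exchange_big /= mul2n -addnn.
    have e a : a \in S0 -> #|out a| = \sum_(b in S0) (b \in out a : nat).
      move=> aS; rewrite -sum1_card big_mkcond [RHS]big_mkcond; apply: eq_bigr => b _.
      case: (boolP (b \in out a)) => [bo|_]; last by case: ifP.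
      by have := subsetP (out_nbhd a aS) b bo; rewrite inE => /andP[->].
    by congr (_ + _); apply: eq_bigr.
  rewrite degsum_pairs; apply: leq_sum => a aS; apply: leq_sum => b bS.
  by case: (boolP (adj a b)) => // /(out_total a b aS bS)[->|->]; rewrite ?leq_addl ?leq_addr.
(* The orientation has at least d #|S0| / 2 out-edges and out-degrees at most 2 d. *)
pose A1 := [set a in S0 | d <= 4 * #|out a|].
have A1_large : #|S0| <= 8 * #|A1|.
  have := @large_part_card _ S0 (fun a => #|out a|) d 4 (2 * d) out_le; rewrite -/A1 => H.
  rewrite -(leq_pmul2l d0); apply: leq_trans (H _) _; last by apply: eq_leq; lia.
  by move: dsS0 out_sum; clear; lia.
pose A0 := A1 :\: [set a in S0 | 64 * d <= #|nbhd a S0|].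
have A0_S0 : A0 \subset S0 by apply/subsetP => a /setDP[/setIdP[]].
have A0_out a : a \in A0 -> d <= 4 * #|out a| by case/setDP => /setIdP[].
have A0_low : low_degree d S0 64 A0.
  move=> a aA; have aS := subsetP A0_S0 a aA; case/setDP: aA => _.
  by rewrite inE aS /= -ltnNge => /ltnW.
have A0_large : #|S0| <= 16 * #|A0|.
  have := markov_card S0 (fun a => #|nbhd a S0|) (64 * d).
  set B := [set a in S0 | _] => H; have {}H : 16 * #|B| <= #|S0|.
    by rewrite -(leq_pmul2l d0); have := leq_trans H dsS0'; clear; lia.
  have : #|A1| <= #|A0| + #|B|.
    apply: leq_trans (leq_card_setU _ _); apply: subset_leq_card; apply/subsetP => a aA.
    by rewrite in_setU in_setD aA andbT orNb.
  by move: H A1_large; clear; lia.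
have A0_w : w k * d <= #|A0|.
  rewrite leqNgt; apply/negP => lt; have := hier_Nw hier; have wk := hier_wk hier.
  have S0_le : #|S0| <= 16 * w k * d by move: lt A0_large; clear; lia.
  rewrite ltnNge => /negP; apply.
  have := sparse _ S0_le; rewrite muln_gt0 wk => /(_ isT) sp.
  have dd : 0 < d ^ 2 by rewrite expn_gt0 d0.
  rewrite -(leq_pmul2r dd); apply: leq_trans sp; rewrite leq_mul2l; apply/orP; right.
  by apply: leq_trans dsS0; rewrite -mulnn leq_mul2l (ltnW dS0) orbT.
have A0pos : 0 < #|A0| by move: A0_large S0pos; clear; lia.
have [deadA|aliveA] := boolP (dead_at d out g w k A0); last first.
  have [//|[a aA many]] := dead_or_many_alive d_gt1 sparse out_nbhd out_le out_total k_gt0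
    (hier_scales hier) A0_S0 A0_low A0_w A0pos aliveA.
  have aS := subsetP A0_S0 a aA.
  by apply: (alive_C4_free_dense d_gt1 sparse out_nbhd out_le k_gt0 (hier_prime hier)
    (hier_kp hier) A0_S0 A0_low aS many (hier_w0 hier) (hier_E hier) (hier_W hier)
    (hier_dW hier) (hier_NW hier)).
move: deadA => /and3P[_ _]; rewrite (hier_gk hier) => deadA.
have := dead_singles_dense d0 out_nbhd dsS0' A0_S0 A0_large A0_out A0_low deadA
  (hier_Cw hier) (hier_C hier).
set R := [set v in S0 | _] => denseR.
have C0 : 0 < C by apply: leq_trans (hier_C hier).
apply: (light_C4_free_dense sparse C0 k_gt0 (hier_dk hier) S0pos _ _ denseR (hier_NC hier)).
  have RS : R \subset S0 by apply/subsetP => x; rewrite inE => /andP[].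
  move=> x; rewrite inE => /andP[_]; apply: leq_trans.
  exact/subset_leq_card/nbhdS.
by apply: subset_leq_card; apply/subsetP => x; rewrite inE => /andP[].
Qed.
End Core.

(** For d < d0, any set of d vertices that spans an edge is dense enough, because
N >= d0 ^ 2. *)
Lemma C4_free_dense_or_dense_spot k : 0 < k -> exists2 N, 0 < N &
  forall d (G : sgraph), 1 < d -> 0 < #|G| -> d * #|G| <= degsum [set: G] ->
  C4_free_dense G k \/ exists2 U : {set G}, #|U| = d & d ^ 2 <= N * degsum U.
Proof.
move=> k0; have [g [w [p [E [W [C [N0 [d0 hier]]]]]]]] := hierarchy_exists k0.
exists (N0 + d0 ^ 2 + 1); first by rewrite addn1.
move=> d G d1 G0 dense; set N := N0 + d0 ^ 2 + 1.
have dG : d <= #|G|.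
  have := leq_trans dense (degsum_le _); rewrite cardsT [leqRHS]mulnC leq_pmul2r //; lia.
case: (boolP [exists U : {set G}, (#|U| == d) && (d ^ 2 <= N * degsum U)]) => [|/existsPn none].
  by case/existsP => U /andP[/eqP cU dU]; right; exists U.
have sparse0 (U : {set G}) : #|U| = d -> N * degsum U < d ^ 2.
  by move=> cU; have := none U; rewrite cU eqxx ltnNge.
left; case: (leqP d0 d) => dd0.
  apply: (dense_C4_free_dense k0 (hier N d _ dd0) d1) => //.
    by rewrite /N -addnA leq_addr.
  by move=> L U; exact: local_sparsity.
exfalso.
have [x [y xy]] : exists x, exists y : G, adj x y.
  have : 0 < degsum [set: G] by apply: leq_trans dense; rewrite muln_gt0 (ltnW d1).
  rewrite lt0n sum_nat_eq0 => /forall_inPn[x _]; rewrite -lt0n => /card_gt0P[y].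
  by rewrite inE => /andP[_ xy]; exists x, y.
have nxy : x != y by apply: contraTneq xy => ->; rewrite adj_irr.
have [U sU cU] : exists2 U : {set G}, [set x; y] \subset U & #|U| = d.
  by apply: superset_of_card; rewrite cards2 nxy d1.
have := sparse0 U cU; apply/negP; rewrite -leqNgt.
have : 0 < degsum U.
  apply: leq_trans (degsumS sU); rewrite degsum_pairs.
  by rewrite (bigD1 x) ?inE ?eqxx //= (bigD1 y) ?inE ?eqxx ?orbT //= xy.
move=> ds; apply: (@leq_trans N); last by rewrite leq_pmulr.
by apply: (@leq_trans (d0 ^ 2)); [rewrite leq_exp2r // ltnW | rewrite /N; lia].
Qed.

(** * From degree sums to average degrees *)

Lemma sum_degree_setT (G : sgraph) : \sum_(x : G) degree x = degsum [set: G].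
Proof.
rewrite /degsum; apply: eq_big => [x|x _]; first by rewrite inE.
by apply: eq_card => y; rewrite !inE.
Qed.

Lemma sum_degree_induced (G : sgraph) (S : {set G}) :
  \sum_(x : induced S) degree x = degsum S.
Proof.
rewrite /degsum (reindex_omap (op := addn) (val : induced S -> G) insub) /=; last first.
  by move=> x xS; rewrite insubT.
apply: eq_big => [[x xS]|[x xS] _] /=; first by rewrite xS insubT eqxx.
rewrite /degree -(card_imset _ val_inj); apply: eq_card => y; rewrite inE.
apply/imsetP/andP => [[[z zS]]|[yS xy]].
  by rewrite inE => xz ->; split; [exact: zS | exact: xz].
by exists (exist _ y yS); rewrite ?inE.
Qed.

(** An edge is spanned by at most two ordered pairs. *)
Lemma sum_degree_edges (H : sgraph) : \sum_(x : H) degree x <= 2 * #|edges H|.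
Proof.
have -> : \sum_(x : H) degree x = \sum_(p : H * H | adj p.1 p.2) 1.
  rewrite -(pair_big_dep predT (fun x y : H => adj x y) (fun _ _ => 1)) /=.
  by apply: eq_bigr => x _; rewrite sum1dep_card.
rewrite (partition_big (fun p : H * H => [set p.1; p.2]) (mem (edges H))) /=; last first.
  move=> p pa; apply/imsetP; exists p; [by rewrite inE | by []].
rewrite mulnC -sum_nat_const; apply: leq_sum => e /imsetP[[a b] /= _ ->].
rewrite sum1dep_card; apply: (@leq_trans #|[set (a, b); (b, a)]|); last by rewrite cards2; case: eqP.
apply: subset_leq_card; apply/subsetP => -[x y]; rewrite !inE /= => /andP[xy /eqP e2].
have nxy : x != y by apply: contraTneq xy => ->; rewrite adj_irr.
have : x \in [set a; b] by rewrite -e2 !inE eqxx.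
have : y \in [set a; b] by rewrite -e2 !inE eqxx orbT.
rewrite !inE !xpair_eqE => /orP[] /eqP ey /orP[] /eqP ex; subst; rewrite ?eqxx ?orbT //.
  by rewrite eqxx in nxy.
by rewrite eqxx in nxy.
Qed.

Lemma no_C4_induced (G : sgraph) (S : {set G}) : no_C4 S -> C4_free (induced S).
Proof.
move=> noC [s [s4 /andP[cyc uni]]].
case: s s4 cyc uni => [|x [|y [|z [|v [|? ?]]]]] //= _ /and5P[xy yz zv vx _] uni.
have := noC _ _ _ _ (valP x) (valP y) (valP z) (valP v) xy yz zv vx.
by move: uni; rewrite !inE !negb_or => /and4P[/and3P[_ /negP xz _] /andP[_ /negP yv] _ _]
  [/val_inj/eqP|/val_inj/eqP].
Qed.

Import Order.TTheory GRing.Theory Num.Theory.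
Local Open Scope ring_scope.

Theorem theorem1p9 (R : realType) (k : nat) (hk : (0 < k)%N) :
  exists c : R, 0 < c /\
    forall (d : nat) (G : sgraph), (2 <= d)%N -> d%:R <= avg_degree R G ->
      (exists S : {set G},
         C4_free (induced S) /\ k%:R <= avg_degree R (induced S)) \/
      (exists H : sgraph,
         [/\ is_subgraph H G, #|H| = d & c * d%:R ^+ 2 <= #|edges H|%:R]).
Proof.
have [N N_gt0 dichotomy] := C4_free_dense_or_dense_spot hk.
have N2 : 0 < (N * 2)%:R :> R by rewrite ltr0n muln_gt0 N_gt0.
(* degsum counts every edge twice. *)
exists ((N * 2)%:R^-1); split; first by rewrite invr_gt0.
move=> d G d_ge2 dense.
have G_gt0 : (0 < #|G|)%N.
  rewrite lt0n; apply: contraTneq dense => G0.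
  by rewrite /avg_degree G0 invr0 mulr0 -ltNge ltr0n; exact: ltnW.
have {}dense : (d * #|G| <= degsum [set: G])%N.
  by move: dense; rewrite /avg_degree ler_pdivlMr ?ltr0n // -natrM ler_nat sum_degree_setT.
case: (dichotomy d G d_ge2 G_gt0 dense) => [[S [S0 noC kS]]|[U cU dU]].
  left; exists S; split; first exact: no_C4_induced.
  rewrite /avg_degree sum_degree_induced card_sig ler_pdivlMr ?ltr0n ?card_gt0 //.
  by rewrite -natrM ler_nat.
right; exists (induced U); split.
- by exists val; split => //; exact: val_inj.
- by rewrite card_sig.
- rewrite mulrC ler_pdivrMr // -natrX -natrM ler_nat.
  have := sum_degree_edges (induced U); rewrite sum_degree_induced => handshake.
  apply: leq_trans dU _; apply: (@leq_trans (N * (2 * #|edges (induced U)|))).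
    by rewrite leq_mul2l handshake orbT.
  by rewrite mulnA mulnC.
Qed.
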